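(* Let $r$ be a fixed non-zero integer with $3\nmid r$, let $g$ be a non-zero integer, and let $E/\mathbb{Q}$ be the elliptic curve $y^2=x^3+g$. Then $\varpi_{E,r}$ vanishes if and only if one of the following 18 conditions holds. (I) $\{2,3,6\}\subseteq\mathcal{J}_5(g,r)\cup\mathcal{J}_7(g,r)$ and one of: - $r\equiv8\ (\mathrm{mod}\ 24)$, $3\mid\mu$, $3\mid\lambda+\frac{g_1^2-1}{3}$, $(-1)^{\delta+\lambda+\mu}=(\frac{g_1}{3})$; - $r\equiv16\ (\mathrm{mod}\ 24)$, $3\mid\mu$, $3\mid\lambda+\frac{g_1^2-1}{3}$, $(-1)^{\delta+\lambda+\mu}=(\frac{-g_1}{3})$; - $r\equiv20\ (\mathrm{mod}\ 24)$, $3\mid\mu$, $3\mid\lambda+\frac{g_1^2-1}{3}$, $(-1)^{\delta+\mu}=(\frac{g_1}{3})$; - $r\equiv4\ (\mathrm{mod}\ 24)$, $3\mid\mu$, $3\mid\lambda+\frac{g_1^2-1}{3}$, $(-1)^{\delta+\mu}=(\frac{-g_1}{3})$; - $r\equiv2\ (\mathrm{mod}\ 12)$, $g_1\equiv1,11\ (\mathrm{mod}\ 12)$, $3\mid\mu$, $3\mid\lambda+\frac{g_1^2-1}{3}$, $2\mid\lambda$; - $r\equiv10\ (\mathrm{mod}\ 12)$, $g_1\equiv5,7\ (\mathrm{mod}\ 12)$, $3\mid\mu$, $3\mid\lambda+\frac{g_1^2-1}{3}$, $2\mid\lambda$; - $r\equiv5\ (\mathrm{mod}\ 6)$, $g_1\equiv1,11\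 (\mathrm{mod}\ 12)$, $3$ divides each of $\mu$, $2+\lambda$, $\frac{g_1^2+2}{3}$, and $2$ divides both $\lambda$ and $\delta+\mu+\frac{g_1-1}{2}$; - $r\equiv1\ (\mathrm{mod}\ 6)$, $g_1\equiv5,7\ (\mathrm{mod}\ 12)$, $3$ divides each of $\mu$, $2+\lambda$, $\frac{g_1^2+2}{3}$, and $2$ divides both $\lambda$ and $\delta+\mu+\frac{g_1-1}{2}$. (II) $\mathfrak{A}_2(g_1)\mid r$ and one of: - $r\equiv8\ (\mathrm{mod}\ 24)$, $(-1)^{\delta+\lambda+\mu}=(\frac{-g_1}{3})$; - $r\equiv16\ (\mathrm{mod}\ 24)$, $(-1)^{\delta+\lambda+\mu}=(\frac{g_1}{3})$; - $r\equiv20\ (\mathrm{mod}\ 24)$, $(-1)^{\delta+\mu}=(\frac{-g_1}{3})$; - $r\equiv4\ (\mathrm{mod}\ 24)$, $(-1)^{\delta+\mu}=(\frac{g_1}{3})$; - $r\equiv2\ (\mathrm{mod}\ 12)$, $g_1\equiv5,7\ (\mathrm{mod}\ 12)$, $2\mid\lambda$; - $r\equiv10\ (\mathrm{mod}\ 12)$, $g_1\equiv1,11\ (\mathrm{mod}\ 12)$, $2\mid\lambda$; - $r\equiv5\ (\mathrm{mod}\ 6)$, $g_1\equiv5,7\ (\mathrm{mod}\ 12)$, $2$ divides both $\lambda$ and $\delta+\mu+\frac{g_1-1}{2}$; - $r\equiv1\ (\mathrm{mod}\ 6)$, $g_1\equiv1,11\ (\mathrm{mod}\ 12)$, $2$ divides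 both $\lambda$ and $\delta+\mu+\frac{g_1-1}{2}$. (III) $\mathfrak{A}_3(g_1)\mid r$ and one of: - $r\equiv\pm1\ (\mathrm{mod}\ 6)$, $g_1\equiv1,8\ (\mathrm{mod}\ 9)$, $3$ divides both $\lambda$ and $\mu$; - $r\equiv\pm1\ (\mathrm{mod}\ 6)$, $g_1\equiv2,7\ (\mathrm{mod}\ 9)$, $3$ divides both $\lambda+1$ and $\mu$.
   Context: Write $g=(-1)^\delta2^\lambda3^\mu g_1$ with $\delta\in\{0,1\}$, integers $\lambda,\mu\geqslant0$, $g_1\geqslant1$, $\gcd(g_1,6)=1$. For $j,q\in\mathbb{Z}_{\geqslant1}$, $\mathfrak{A}_j(q)=\prod_{p^\nu\parallel q,\ j\nmid\nu}p$. For a prime $p$, $\mathcal{J}_p(g,r)=\{j\in\mathbb{Z}_{\geqslant1}:\ j\nmid\mathrm{ord}_p(g_1),\ p\nmid r,\ \mathfrak{A}_j(g_1)\mid pr\}$, where $\mathrm{ord}_p$ is the $p$-adic valuation (so $j\mid 0$ always). For $3\nmid r$ the constant is $$\varpi_{E,r}=\frac{h_{3,r}}{6}\Big(1+\varsigma_2\Big(\frac3{g_1}\Big)\Omega_2+\widehat\mu\,\varsigma_1\Big(\Omega_3+\varsigma_2\Big(\frac3{g_1}\Big)\Omega_6\Big)\Big),$$ with $\Omega_j=\prod_{p^\nu\parallel g_1,\ p\nmid r,\ j\nmid\nu}\frac{-1}{p-1-(\frac{-3}{p})}$ (empty product $=1$); $\widehat\mu=\frac23$ if $3\mid\mu$,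 else $0$; with $\omega=e^{2\pi i/3}$, $\varsigma_1=1+2\Re(\omega^{\lambda+\frac{g_1^2-1}{3}})$ for $r\equiv\pm2$ mod $6$ and $\varsigma_1=\Re(\omega^{1-\lambda}+\omega^{1+\frac{g_1^2-1}{3}}+\omega^{2-\lambda+\frac{g_1^2-1}{3}})$ for $r\equiv\pm5$ mod $6$; $\varsigma_2=\pm(-1)^{\delta+\lambda+\mu+\frac{g_1-1}{2}}$ for $r\equiv\pm8$ mod $24$; $\pm(-1)^{\delta+\mu+\frac{g_1-1}{2}}$ for $r\equiv\pm20$ mod $24$; $\pm\frac{1+(-1)^\lambda}{2}$ for $r\equiv\pm2$ mod $12$; $\pm\frac14(1+(-1)^\lambda)(1+(-1)^{\delta+\mu+\frac{g_1-1}{2}})$ for $r\equiv\pm5$ mod $6$ (signs corresponding). $h_{3,r}=\xi\cdot\frac{\sqrt3}{2}\prod_{p\nmid2r}\big(1-\frac{(\frac{-3}{p})}{p-1}\big)$, $\xi=1$ if $2\mid r$ and $\xi=2$ if $2\nmid r$ (for $3\nmid r$); the product over primes is in increasing order. $(\frac\cdot\cdot)$ is the Legendre/Jacobi symbol. *)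

(* Defs.v *)
From HB Require Import structures.
From mathcomp Require Import all_boot all_order all_algebra.
From mathcomp Require Import all_classical all_reals all_analysis.
From mathcomp Require Import complex zify.
Set Implicit Arguments.
Unset Strict Implicit.
Unset Printing Implicit Defensive.
Import Order.TTheory GRing.Theory Num.Theory.
Import numFieldNormedType.Exports.
Local Open Scope classical_set_scope.
Local Open Scope ring_scope.

(* Only meaningful for p an odd prime. *)
Definition legendre (a : int) (p : nat) : int :=
  if (p%:Z %| a)%Z then 0
  else if [exists x : 'I_p, (a == (x : nat)%:Z ^+ 2 %[mod p%:Z])%Z] then 1
  else -1.

(* Only meaningful for n odd and positive. *)
Definition jacobi (a : int) (n : nat) : int :=
  \prod_(p <- primes n) legendre a p ^+ logn p n.

(* The decomposition g = (-1)^delta 2^lambda 3^mu g1 with gcd(g1, 6) = 1, for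
   g != 0; see factorization_g below. *)
Definition delta (g : int) : nat := (g < 0)%R.
Definition lambda (g : int) : nat := logn 2 `|g|%N.
Definition mu (g : int) : nat := logn 3 `|g|%N.
Definition g1 (g : int) : nat := (`|g| %/ (2 ^ lambda g * 3 ^ mu g))%N.

Lemma factorization_g (g : int) : g != 0 ->
  [/\ (delta g <= 1)%N, (1 <= g1 g)%N, coprime (g1 g) 6 &
      g = (-1) ^+ delta g * 2 ^+ lambda g * 3 ^+ mu g * (g1 g)%:Z].
Proof.
move=> g0; have n0 : (0 < `|g|)%N by rewrite absz_gt0.
have [m2 m2c m2E] := pfactor_coprime (isT : prime 2) n0.
have m20 : (0 < m2)%N by move: n0; rewrite m2E muln_gt0 => /andP[].
have [m3 m3c m3E] := pfactor_coprime (isT : prime 3) m20.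
have l3 : logn 3 m2 = mu g.
  by rewrite /mu m2E lognM ?expn_gt0// lognX (_ : logn 3 2 = 0)%N// muln0 addn0.
have gE : `|g|%N = (m3 * (2 ^ lambda g * 3 ^ mu g))%N.
  by rewrite m2E {1}m3E l3 -mulnA (mulnC (3 ^ _)%N).
have g1E : g1 g = m3 by rewrite /g1 gE mulnK// muln_gt0 !expn_gt0.
split; first by rewrite /delta; case: (g < 0)%R.
- by rewrite g1E; move: m20; rewrite m3E muln_gt0 => /andP[].
- rewrite g1E (_ : 6 = 2 * 3)%N// coprimeMr !(coprime_sym m3) m3c andbT.
  by move: m2c; rewrite m3E coprimeMr => /andP[].
rewrite {1}[g]intEsign {1}gE g1E /delta -!mulrA; congr (_ * _).
rewrite mulnC !PoszM -mulrA; congr (_ * (_ * _)).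
- by rewrite -[LHS]/((2 ^ lambda g)%N%:Z) -natz natrX.
by rewrite -[LHS]/((3 ^ mu g)%N%:Z) -natz natrX.
Qed.

Definition frakA (j q : nat) : nat :=
  \prod_(p <- primes q | ~~ (j %| logn p q)%N) p.

Definition calJ (p : nat) (g r : int) : set nat :=
  [set j | [/\ (1 <= j)%N, ~~ (j %| logn p (g1 g))%N, ~~ (p%:Z %| r)%Z
             & ((frakA j (g1 g))%:Z %| p%:Z * r)%Z]].

Section Constant.
Variable R : realType.

(* Conditionally convergent product over the primes in increasing order. *)
Definition h3 (r : int) : R :=
  (if (2 %| r)%Z then 1 else 2) * (Num.sqrt 3 / 2) *
  lim ((fun n => \prod_(p < n | prime p && ~~ ((p : nat)%:Z %| 2 * r)%Z)
         (1 - (legendre (-3) p)%:~R / (p%:R - 1) : R)) @ \oo).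

Definition Omega (j : nat) (g r : int) : R :=
  \prod_(p <- primes (g1 g)
           | ~~ (p%:Z %| r)%Z && ~~ (j %| logn p (g1 g))%N)
    (-1 / (p%:R - 1 - (legendre (-3) p)%:~R)).

Definition muhat (g : int) : R := if (3 %| mu g)%N then 2 / 3 else 0.

Definition omega : R[i] := Complex (cos (2 * pi / 3)) (sin (2 * pi / 3)).

(* The last branch is reached only when 3 divides r. *)
Definition varsigma1 (g r : int) : R :=
  let l := (lambda g)%:Z in
  let c := (((g1 g ^ 2 - 1) %/ 3)%N)%:Z in
  if ((r == 2 %[mod 6]) || (r == -2 %[mod 6]))%Z then
    1 + 2 * complex.Re (omega ^ (l + c))
  else if ((r == 5 %[mod 6]) || (r == -5 %[mod 6]))%Z then
    complex.Re (omega ^ (1 - l) + omega ^ (1 + c) + omega ^ (2 - l + c))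
  else 0.

(* The last branch is reached only when 3 divides r. *)
Definition varsigma2 (g r : int) : R :=
  let d := delta g in let l := lambda g in let m := mu g in
  let e := ((g1 g - 1) %/ 2)%N in
  let s8 := (-1) ^+ (d + l + m + e) in
  let s20 := (-1) ^+ (d + m + e) in
  let s2 := (1 + (-1) ^+ l) / 2 in
  let s5 := 1 / 4 * (1 + (-1) ^+ l) * (1 + (-1) ^+ (d + m + e)) in
  if (r == 8 %[mod 24])%Z then s8 else
  if (r == -8 %[mod 24])%Z then - s8 else
  if (r == 20 %[mod 24])%Z then s20 else
  if (r == -20 %[mod 24])%Z then - s20 else
  if (r == 2 %[mod 12])%Z then s2 else
  if (r == -2 %[mod 12])%Z then - s2 else
  if (r == 5 %[mod 6])%Z then s5 else
  if (r == -5 %[mod 6])%Z then - s5 else 0.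

(* The constant attached to y^2 = x^3 + g and r, for r not divisible by 3. *)
Definition varpi (g r : int) : R :=
  let s := varsigma2 g r * (jacobi 3 (g1 g))%:~R in
  h3 r / 6 *
  (1 + s * Omega 2 g r
     + muhat g * varsigma1 g r * (Omega 3 g r + s * Omega 6 g r)).

End Constant.

(* Main.v *)
Require Import Defs.
From HB Require Import structures.
From mathcomp Require Import all_boot all_order all_algebra.
From mathcomp Require Import all_solvable all_field.
From mathcomp Require Import all_classical all_reals all_analysis.
From mathcomp Require Import ring lra zify complex.
Set Implicit Arguments.
Unset Strict Implicit.
Unset Printing Implicit Defensive.
Import Order.TTheory GRing.Theory Num.Theory.
Import numFieldNormedType.Exports.
Local Open Scope classical_set_scope.
Local Open Scope ring_scope.

(** The constant is [h3 r / 6] times [1 + s Omega_2 + T (Omega_3 + s Omega_6)]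
    with [s] in [{0, 1, -1}] and [T] in [{0, 2, -1}].

    The factor [h3 r] is not zero because its Euler product converges.  With
    [chi] the nonprincipal character modulo 3, one has [(-3/p) = chi p], and
    expanding [ln n] as a sum over the prime powers dividing [n] turns
    [sum chi(n) ln(n) / n] into [L(1, chi) sum chi(p^k) ln(p) / p^k] up to an
    error controlled by Chebyshev's bound.  Since [L(1, chi) >= 1/2], the sums
    [sum chi(p) ln(p) / p] are bounded, and summation by parts against
    [1 / ln p] shows that [sum chi(p) / p] converges, hence so does the sum of
    the logarithms of the factors.

    Let [x], [y], [z] be the products of the weights over the primes counted in
    [Omega_2] only, in [Omega_3] only, and in both.  Then [Omega_2 = x z],
    [Omega_3 = y z], [Omega_6 = x y z].  A weight has absolute value at most
    [1/5], with equality only at 5 and 7, where it is [- 1/5].  If [z = 1], the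
    second factor is [(1 + s x) (1 + T y)]; otherwise its terms other
    than 1 add up to at most 1 in absolute value, and they cancel the 1 only if
    [s = 1], [T = 2], [x = y = 1] and [z = - 1/5]. *)

(** * The character modulo 3 and Chebyshev's bound *)

Lemma abel_sum_le (R : realType) (a b : nat -> R) (B : R) (m n : nat) :
  (m <= n)%N ->
  (forall i, (m <= i < n)%N -> a i.+1 <= a i) ->
  (forall i, (m <= i <= n)%N -> 0 <= a i) ->
  (forall k, (m <= k <= n)%N -> `|\sum_(m <= i < k) b i| <= B) ->
  `|\sum_(m <= i < n) b i * a i| <= B * a m.
Proof.
move=> mn dec pos hb.
have mmn : (m <= m <= n)%N by rewrite leqnn.
have nmn : (m <= n <= n)%N by rewrite mn leqnn.
(* Summation by parts in a form suited to induction: the boundary term [B_k a_k] is split off, and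
   what remains is a sum of [B_i (a_i - a_i.+1)], whose weights telescope. *)
suff H k : (m <= k <= n)%N ->
    `|\sum_(m <= i < k) b i * a i - (\sum_(m <= i < k) b i) * a k|
      <= B * (a m - a k).
  rewrite -[X in `|X|](subrK ((\sum_(m <= i < n) b i) * a n)).
  rewrite (le_trans (ler_normD _ _))// [leRHS](_ : _ = B * (a m - a n) + B * a n).
    by rewrite lerD// ?H// normrM (ger0_norm (pos _ nmn)) ler_wpM2r// ?pos ?hb.
  by ring.
elim: k => [|k IHk] mkn.
  have -> : m = 0%N by lia.
  by rewrite !big_geq// mul0r !subrr mulr0 normr0.
have [mk|km] := leqP m k; last first.
  have -> : m = k.+1 by lia.
  by rewrite !big_geq// mul0r !subrr mulr0 normr0.
rewrite !big_nat_recr//=.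
set S := \sum_(_ <= i < _) b i; set T := \sum_(_ <= i < _) _ * _.
rewrite (_ : _ - _ = T - S * a k + (S + b k) * (a k - a k.+1)); last by ring.
have -> : B * (a m - a k.+1) = B * (a m - a k) + B * (a k - a k.+1) by ring.
rewrite (le_trans (ler_normD _ _))// lerD ?IHk//; first by lia.
have d : 0 <= a k - a k.+1 by rewrite subr_ge0 dec//; lia.
rewrite normrM (ger0_norm d) ler_wpM2r//.
by have := hb k.+1 mkn; rewrite big_nat_recr//=.
Qed.

Lemma cvgn_tail_le (R : realType) (u e : nat -> R) (N : nat) :
  (e n @[n --> \oo] --> 0) ->
  (forall m n, (N <= m <= n)%N -> `|u n - u m| <= e m) ->
  cvgn u.
Proof.
move=> e0 ue.
suff : cauchy (u n @[n --> \oo]) by move/cauchy_cvgP.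
apply: cauchy_exP => eps eps0.
have [M _ MP] := (cvgr0Pnorm_lt e).1 e0 _ eps0.
exists (u (maxn M N)); exists (maxn M N) => // n /= Mn.
rewrite /ball /= distrC (le_lt_trans (ue (maxn M N) n _))//.
  by rewrite leq_maxr.
by apply: (le_lt_trans (ler_norm _)); apply: MP => /=; rewrite leq_maxl.
Qed.

Lemma lim_tail_le (R : realType) (u : nat -> R) (c : R) (m : nat) :
  cvgn u -> (forall n, (m <= n)%N -> `|u n - u m| <= c) ->
  `|limn u - u m| <= c.
Proof.
move=> cu h.
rewrite ler_norml; apply/andP; split.
  rewrite -lerBlDr opprK addrC; apply: limr_ge => //.
  exists m => // n /= /h; rewrite ler_norml => /andP[]; lra.
rewrite lerBlDr; apply: limr_le => //.
exists m => // n /= /h; rewrite ler_norml => /andP[]; lra.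
Qed.

Definition chi3 (n : nat) : int :=
  if (n %% 3 == 1)%N then 1 else if (n %% 3 == 2)%N then -1 else 0.

Lemma chi3M (m n : nat) : chi3 (m * n) = chi3 m * chi3 n.
Proof.
rewrite /chi3 -modnMml -modnMmr.
have : (m %% 3 < 3)%N by rewrite ltn_mod.
have : (n %% 3 < 3)%N by rewrite ltn_mod.
by case: (m %% 3)%N => [|[|[|]]]//; case: (n %% 3)%N => [|[|[|]]].
Qed.

Lemma norm_chi3_le1 (R : realType) (n : nat) : `|(chi3 n)%:~R : R| <= 1.
Proof.
by rewrite /chi3; case: ifP => _; last case: ifP => _;
  rewrite ?rmorphN ?normrN ?normr1 ?normr0.
Qed.

Lemma sum_chi3 (n : nat) : \sum_(0 <= i < n) chi3 i = (n %% 3 == 2)%N%:Z.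
Proof.
elim: n => [|n IH]; first by rewrite big_geq.
rewrite big_nat_recr//= IH /chi3.
have e : (n.+1 %% 3 = if n %% 3 == 2 then 0 else (n %% 3).+1)%N by case: ifP; lia.
rewrite e; have : (n %% 3 < 3)%N by rewrite ltn_mod.
by case: (n %% 3)%N => [|[|[|]]].
Qed.

(** A block sum is a difference of two initial sums, each 0 or 1. This is the bound [B = 1] fed to
    [abel_sum_le]. *)
Lemma norm_sum_chi3_le1 (R : realType) (m n : nat) : (m <= n)%N ->
  `|\sum_(m <= i < n) (chi3 i)%:~R : R| <= 1.
Proof.
move=> mn; rewrite -rmorph_sum /=.
have -> : \sum_(m <= i < n) chi3 i = (n %% 3 == 2)%N%:Z - (m %% 3 == 2)%N%:Z.
  by rewrite -!sum_chi3 (big_cat_nat (leq0n m) mn)/= addrAC subrr add0r.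
by case: (n %% 3 == 2)%N; case: (m %% 3 == 2)%N;
  rewrite ?subrr ?subr0 ?sub0r ?rmorphN ?normrN ?normr1 ?normr0.
Qed.

Lemma sum_dvdn (V : nmodType) (F : nat -> V) (d N : nat) : (0 < d)%N ->
  \sum_(1 <= n < N.+1 | (d %| n)%N) F n =
  \sum_(1 <= m < (N %/ d).+1) F (d * m)%N.
Proof.
move=> d0; elim: N => [|N IH]; first by rewrite div0n !big_geq.
rewrite big_mkcond big_nat_recr//= -big_mkcond/= IH divnS//.
case: ifP => dN /=; last by rewrite addr0.
rewrite add1n [RHS]big_nat_recr//=; congr (_ + F _).
by rewrite -[LHS](divnK dN) divnS// dN mulnC.
Qed.

Lemma sum_leq (R : pzSemiRingType) (l M : nat) : (l < M)%N ->
  \sum_(1 <= k < M) (k <= l)%N%:R = l%:R :> R.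
Proof.
move=> lM; rewrite (big_cat_nat (n := l.+1))//= [X in _ + X]big_nat_cond.
rewrite [X in _ + X]big1 ?addr0; last first.
  by move=> k /andP[/andP[lk _] _]; rewrite leqNgt lk.
elim: l {lM} => [|l IH]; first by rewrite big_geq.
rewrite big_nat_recr//= leqnn -natr1 -[in RHS]IH; congr (_ + _).
by apply: eq_big_nat => k kl; congr (nat_of_bool _)%:R; lia.
Qed.

Lemma ln_prod_nat (R : realType) (I : Type) (s : seq I) (P : pred I)
    (F : I -> R) : (forall i, P i -> 0 < F i) ->
  ln (\prod_(i <- s | P i) F i) = \sum_(i <- s | P i) ln (F i).
Proof.
move=> F0.
suff [] : ln (\prod_(i <- s | P i) F i) = \sum_(i <- s | P i) ln (F i) /\
  0 < \prod_(i <- s | P i) F i by [].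
apply: (big_rec2 (fun x y => ln x = y /\ 0 < x)); first by rewrite ln1.
by move=> i y x /F0 Fi [<- x0]; rewrite lnM ?posrE// mulr_gt0.
Qed.

(** The convolution identity [ln = Lambda * 1], with the von Mangoldt function spelled out over
    prime powers. Both [p] and [k] range below a common [M], so that the index set does not depend
    on [n] and sums can be exchanged. *)
Lemma ln_sum_pfactor (R : realType) (n M : nat) : (0 < n < M)%N ->
  ln n%:R = \sum_(0 <= p < M | prime p) \sum_(1 <= k < M)
              (p ^ k %| n)%N%:R * ln p%:R :> R.
Proof.
case: M => [|M]; first by rewrite ltn0 andbF.
move=> /andP[n0 nM].
rewrite -{1}(partnT n0) (@widen_partn M _ n nM) natr_prod ln_prod_nat; last first.
  move=> p _; rewrite ltr0n expn_gt0.
  by case: posnP => //= p0; rewrite p0 lognE.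
rewrite [LHS](bigID prime)/= [X in _ + X]big1 ?addr0; last first.
  by move=> p; rewrite lognE => /negbTE ->; rewrite expn0 ln1.
apply: eq_big => // p pp.
rewrite natrX lnXn ?ltr0n ?prime_gt0// -mulr_suml -(mulr_natl (ln _)).
have lM : (logn p n < M.+1)%N by exact: leq_ltn_trans (ltnW (ltn_logl _ n0)) nM.
rewrite -(sum_leq R lM); congr (_ * _).
by apply: eq_bigr => k _; rewrite pfactor_dvdn.
Qed.

(** Used twice: [F = 1] gives Legendre's formula for [ln N!], and [F n = chi(n) / n] gives the sum
    that approximates [L(1, chi)] times a sum over prime powers. *)
Lemma sum_ln_exchange (R : realType) (F : nat -> R) (N M : nat) : (N < M)%N ->
  \sum_(1 <= n < N.+1) F n * ln n%:R =
  \sum_(0 <= p < M | prime p) \sum_(1 <= k < M)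
     ln p%:R * \sum_(1 <= m < (N %/ p ^ k).+1) F (p ^ k * m)%N.
Proof.
move=> NM.
transitivity (\sum_(1 <= n < N.+1) \sum_(0 <= p < M | prime p)
   \sum_(1 <= k < M) F n * ((p ^ k %| n)%N%:R * ln p%:R)).
  rewrite [LHS]big_nat_cond [RHS]big_nat_cond; apply: eq_bigr => n nN.
  rewrite (@ln_sum_pfactor _ _ M); last by lia.
  by rewrite mulr_sumr; apply: eq_bigr => p _; rewrite mulr_sumr.
rewrite exchange_big_nat /=; apply: eq_bigr => p pp.
rewrite exchange_big_nat /=; apply: eq_bigr => k _.
rewrite -sum_dvdn ?expn_gt0 ?prime_gt0// mulr_sumr.
rewrite big_mkcond [RHS]big_mkcond/= [RHS]big_mkcond/=; apply: eq_bigr => n _.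
by case: ifP => _; rewrite ?mul0r ?mulr0// mul1r mulrC.
Qed.

(** Chebyshev's function at [n] as soon as [n < M]. Cutting the ranges at [M] makes its values at
    [n] and [2n] sums over the same indices, to be compared term by term. *)
Definition psi (R : realType) (M n : nat) : R :=
  \sum_(0 <= p < M | prime p) \sum_(1 <= k < M | (p ^ k <= n)%N) ln p%:R.

Lemma sum_ln_fact (R : realType) (N M : nat) : (N < M)%N ->
  ln N`!%:R = \sum_(0 <= p < M | prime p) \sum_(1 <= k < M)
     ln p%:R * (N %/ p ^ k)%N%:R :> R.
Proof.
move=> NM; rewrite fact_prod natr_prod big_nat_cond ln_prod_nat -?big_nat_cond.
  transitivity (\sum_(1 <= n < N.+1) (fun=> 1) n * ln n%:R : R).
    by apply: eq_bigr => n _; rewrite mul1r.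
  rewrite (sum_ln_exchange _ NM); apply: eq_bigr => p _; apply: eq_bigr => k _.
  by rewrite sumr_const_nat subn1.
by move=> i /andP[/andP[i0 _] _]; rewrite ltr0n.
Qed.

(** For [q = p^k], the contribution of [q] to the exponent of [p] in the central binomial
    coefficient is never negative, and it is at least 1 when [n < q <= 2n]. Terms are moved across
    to avoid truncated subtraction. *)
Lemma leq_divn_double (n q : nat) : (0 < q)%N ->
  ((q <= n.*2) + (n %/ q).*2 <= n.*2 %/ q + (q <= n))%N.
Proof.
move=> q0; have [qn|nq] := leqP q n.
  have := leq_trunc_div n q.
  have -> : (q <= n.*2)%N by lia.
  by rewrite addnC leq_add2r leq_divRL// -!mul2n; lia.
rewrite divn_small//= addn0 addn0; case: (leqP q n.*2) => //= qn.
by rewrite divn_gt0.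
Qed.

Lemma leq_bin_expn2 (n k : nat) : ('C(n, k) <= 2 ^ n)%N.
Proof.
have [kn|nk] := leqP k n; last by rewrite bin_small.
rewrite -addn1 expnDn (bigD1 (Ordinal (kn : (k < n.+1)%N)))//=.
by rewrite !exp1n !muln1 leq_addr.
Qed.

(** Chebyshev's argument: [ln C(2n, n) = ln (2n)! - 2 ln n!] is at least [psi(2n) - psi(n)] by
    Legendre's formula, and at most [n ln 4]. *)
Lemma psi_double (R : realType) (n M : nat) : (n.*2 < M)%N ->
  psi R M n.*2 - psi R M n <= n%:R * ln 4.
Proof.
move=> nM.
apply: (@le_trans _ _ (ln 'C(n.*2, n)%:R)); last first.
  have -> : n%:R * ln 4 = ln (2 ^ n.*2)%N%:R :> R.
    rewrite natrX -mul2n exprM lnXn ?exprn_gt0// -(mulr_natl (ln _)).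
    by congr (_ * ln _); ring.
  by rewrite ler_ln ?posrE ?ltr0n ?expn_gt0 ?bin_gt0 -?addnn ?leq_addr//
    ler_nat leq_bin_expn2.
have -> : ln 'C(n.*2, n)%:R = ln (n.*2)`!%:R - ln n`!%:R *+ 2 :> R.
  have n2 : (n <= n.*2)%N by rewrite -addnn leq_addr.
  rewrite -(bin_fact n2) -{3}addnn addnK !natrM !lnM ?posrE ?mulr_gt0 ?ltr0n;
    rewrite ?fact_gt0 ?bin_gt0//.
  by ring.
rewrite !(@sum_ln_fact R _ M)//; last by lia.
rewrite /psi -sumrMnl -!sumrB; apply: ler_sum => p pp.
rewrite big_mkcond [X in _ - X <= _]big_mkcond -sumrMnl -!sumrB/=.
apply: ler_sum => k _.
have := leq_divn_double n (_ : (0 < p ^ k)%N).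
rewrite expn_gt0 prime_gt0// => /(_ isT).
rewrite -(ler_nat R) !natrD -!mul2n natrM => h.
have lp : 0 <= ln p%:R :> R by rewrite ln_ge0// ler1n prime_gt0.
rewrite (_ : _ - _ = ln p%:R * ((p ^ k <= 2 * n)%N%:R - (p ^ k <= n)%N%:R)).
  rewrite (_ : _ - _ *+ 2 = ln p%:R *
     ((2 * n %/ p ^ k)%N%:R - 2 * (n %/ p ^ k)%N%:R)); last by ring.
  by apply: ler_wpM2l => //; rewrite mul2n; move: h; rewrite -!mul2n; lra.
by do 2 case: ifP => _; rewrite /=; ring.
Qed.

(** Strong induction through [m], half of [n] rounded up: [psi(n) <= psi(2m) <= psi(m) + m ln 4 <=
    3m ln 4], and [3m <= 2n] once [n >= 2]. Since [2m] may equal [n + 1], the range has to satisfy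
    [n.+1 < M]. *)
Lemma psi_le (R : realType) (n M : nat) : (n.+1 < M)%N ->
  psi R M n <= n%:R * (ln 4 *+ 2).
Proof.
have l4 : 0 <= ln 4 :> R by rewrite ln_ge0// ler1n.
elim/ltn_ind: n => -[|[|n]] IH nM.
- rewrite mul0r /psi big1// => p pp; rewrite big1// => k.
  by rewrite leqNgt expn_gt0 prime_gt0.
- rewrite mul1r /psi big1 ?mulrn_wge0// => p pp.
  rewrite big_nat_cond big1// => k /andP[/andP[k0 _]].
  by rewrite leqNgt -(exp1n k) ltn_exp2r// prime_gt1.
pose m := uphalf n.+2.
have := @psi_double R m M; have := IH m; rewrite /m => h1 h2.
have {}h1 := h1 ltac:(lia) ltac:(lia).
have {}h2 := h2 ltac:(lia).
have mono : psi R M n.+2 <= psi R M m.*2.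
  apply: ler_sum => p pp; rewrite big_mkcond [leRHS]big_mkcond/=.
  apply: ler_sum => k _; have [pk|_] := ifP.
    by rewrite (_ : (p ^ k <= m.*2)%N)//; lia.
  by case: ifP => // _; rewrite ln_ge0// ler1n prime_gt0.
rewrite -/m in h1 h2 mono.
have : 3 * m%:R <= 2 * n.+2%:R :> R by rewrite -!natrM ler_nat; lia.
by nra.
Qed.

(** * Sums of the character over primes *)

Definition chi3_sum (R : realType) (n : nat) : R :=
  \sum_(1 <= i < n.+1) (chi3 i)%:~R * i%:R^-1.

Lemma chi3_sum_tail (R : realType) (m n : nat) : (m <= n)%N ->
  `|chi3_sum R n - chi3_sum R m| <= m.+1%:R^-1.
Proof.
move=> mn; rewrite /chi3_sum (big_cat_nat (n := m.+1))//=.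
rewrite addrAC subrr add0r -[leRHS]mul1r.
apply: (@abel_sum_le _ (fun i : nat => i%:R^-1)); first by lia.
- move=> i /andP[mi _]; have i0 : (0 < i)%N by lia.
  by rewrite lef_pV2 ?posrE ?ltr0n// ler_nat.
- by move=> i _; rewrite invr_ge0.
- by move=> k /andP[mk _]; exact: norm_sum_chi3_le1.
Qed.

Lemma is_cvg_chi3_sum (R : realType) : cvgn (chi3_sum R).
Proof.
apply: (@cvgn_tail_le R _ (fun n => n.+1%:R^-1) 0).
  exact: cvg_harmonic.
by move=> m n; exact: chi3_sum_tail.
Qed.

Lemma lim_chi3_sum_tail (R : realType) (n : nat) :
  `|limn (chi3_sum R) - chi3_sum R n| <= n.+1%:R^-1.
Proof.
apply: lim_tail_le; first exact: is_cvg_chi3_sum.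
by move=> m; exact: chi3_sum_tail.
Qed.

(** The first partial sum is 1 and the tail after it is at most [1/2]. *)
Lemma lim_chi3_sum_ge (R : realType) : 1 / 2 <= limn (chi3_sum R).
Proof.
have := lim_chi3_sum_tail R 1.
rewrite {2}/chi3_sum big_nat1 /chi3/= invr1 mulr1 ler_norml => /andP[+ _].
lra.
Qed.

(** From [ln (1 - 1/2) <= - 1/2] one gets [ln 2 >= 1/2], so the threshold [4 = 2^2] comes without a
    numerical estimate of [e]. *)
Lemma ln_ge1 (R : realType) (x : R) : 4 <= x -> 1 <= ln x.
Proof.
move=> x4; apply: (@le_trans _ _ (ln 4)); last first.
  by rewrite ler_ln ?posrE//; lra.
have -> : 4 = 2 ^+ 2 :> R by ring.
rewrite lnXn//.
have : ln (1 + - (1 / 2)) <= - (1 / 2) :> R by apply: le_ln1Dx; lra.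
have -> : 1 + - (1 / 2) = 2^-1 :> R by field.
rewrite lnV ?posrE//; lra.
Qed.

Lemma ln_succ_le (R : realType) (n : nat) : (0 < n)%N ->
  ln n.+1%:R <= ln n%:R + n%:R^-1 :> R.
Proof.
move=> n0; have nR : 0 < n%:R :> R by rewrite ltr0n.
have -> : n.+1%:R = n%:R * (1 + n%:R^-1) :> R.
  by rewrite mulrDr mulfV ?gt_eqF// mulr1 natr1.
rewrite lnM ?posrE ?addr_gt0 ?invr_gt0// lerD2l le_ln1Dx//.
by rewrite (lt_trans _ (_ : 0 < n%:R^-1)) ?invr_gt0//; lra.
Qed.

(** [n ln(n+1) <= n ln n + 1 <= (n+1) ln n], where the last inequality is [ln n >= 1]. *)
Lemma ln_div_decr (R : realType) (n : nat) : (4 <= n)%N ->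
  ln n.+1%:R / n.+1%:R <= ln n%:R / n%:R :> R.
Proof.
move=> n4; have n0 : (0 < n)%N by lia.
have nR : 0 < n%:R :> R by rewrite ltr0n.
have n1R : 0 < n.+1%:R :> R by rewrite ltr0n.
rewrite ler_pdivrMr// mulrAC ler_pdivlMr//.
have h := ln_succ_le R n0.
have l1 : 1 <= ln n%:R :> R by apply: ln_ge1; rewrite ler_nat.
apply: (@le_trans _ _ ((ln n%:R + n%:R^-1) * n%:R)); first by rewrite ler_wpM2r// ltW.
by rewrite mulrDl mulVf ?gt_eqF// -natr1 mulrDr mulr1 lerD2l.
Qed.

(** The terms 1, 2, 3 are at most 1 each since [ln n <= n]; from 4 on [ln n / n] decreases, and
    summation by parts bounds the rest by [ln 4 / 4 <= 1]. *)
Lemma chi3_ln_sum_le (R : realType) (N : nat) : (3 <= N)%N ->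
  `|\sum_(1 <= n < N.+1) ((chi3 n)%:~R / n%:R) * ln n%:R : R| <= 4.
Proof.
move=> N3; rewrite (big_cat_nat (n := 4))//=.
have lnle n : (0 < n)%N -> ln n%:R / n%:R <= 1 :> R.
  by move=> n0; rewrite ler_pdivrMr ?ltr0n// mul1r ltW// ln_sublinear ?ltr0n.
have -> : 4 = 3 + 1 * 1 :> R by ring.
rewrite (le_trans (ler_normD _ _))// lerD//.
  rewrite (le_trans (ler_norm_sum _ _ _))//.
  rewrite [leRHS](_ : _ = \sum_(1 <= n < 4) 1); last first.
    by rewrite sumr_const_nat.
  apply: ler_sum_nat => n /andP[n0 _].
  rewrite -mulrA [_^-1 * _]mulrC normrM -[leRHS]mulr1 ler_pM ?norm_chi3_le1//.
  by rewrite ger0_norm ?lnle// divr_ge0// ln_ge0// ler1n.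
under eq_bigr do rewrite -mulrA [_^-1 * _]mulrC.
apply: (@le_trans _ _ (1 * (ln 4%:R / 4%:R))); last by rewrite !mul1r lnle.
apply: (@abel_sum_le _ (fun n : nat => ln n%:R / n%:R)) => //.
- by move=> i /andP[i4 _]; exact: ln_div_decr.
- by move=> i /andP[i4 _]; rewrite divr_ge0// ln_ge0// ler1n; lia.
- by move=> k /andP[k4 _]; exact: norm_sum_chi3_le1.
Qed.

Lemma chi3_mangoldt_sum_le (R : realType) : exists B : R, forall N, (3 <= N)%N ->
  `|\sum_(0 <= p < N.+2 | prime p) \sum_(1 <= k < N.+2 | (p ^ k <= N)%N)
     ln p%:R * ((chi3 (p ^ k))%:~R / (p ^ k)%:R)| <= B.
Proof.
(* The constant 4 bounds the sum of [chi(n) ln(n) / n], [2 ln 4] the error of replacing partial sums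
   by [L], and the factor 2 comes from dividing by [L >= 1/2]. *)
exists ((4 + ln 4 *+ 2) * 2) => N N3.
set W := \sum_(_ <= p < _ | _) _.
pose L := limn (chi3_sum R); have L2 : 1 / 2 <= L := lim_chi3_sum_ge R.
pose F n : R := (chi3 n)%:~R / n%:R.
have NR : 0 < N%:R :> R by rewrite ltr0n; lia.
suff H : `|\sum_(1 <= n < N.+1) F n * ln n%:R - W * L| <= ln 4 *+ 2.
  have H2 := chi3_ln_sum_le R N3.
  have H3 : `|W * L| <= 4 + ln 4 *+ 2.
    rewrite -[X in `|X|](subKr (\sum_(1 <= n < N.+1) F n * ln n%:R)).
    by rewrite (le_trans (ler_normB _ _))// lerD.
  move: H3; rewrite normrM (ger0_norm (_ : 0 <= L)); last by lra.
  have := normr_ge0 W; nra.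
have psiN : psi R N.+2 N / N%:R <= ln 4 *+ 2.
  by rewrite ler_pdivrMr// mulrC psi_le.
apply: le_trans psiN.
rewrite (@sum_ln_exchange R F N N.+2)// /W /psi !mulr_suml -sumrB.
rewrite (le_trans (ler_norm_sum _ _ _))//; apply: ler_sum => p pp.
rewrite !mulr_suml big_mkcond [leRHS]big_mkcond/=.
rewrite [X in _ - X]big_mkcond/= -sumrB.
rewrite (le_trans (ler_norm_sum _ _ _))//; apply: ler_sum => k _.
set q := (p ^ k)%N.
have q0 : (0 < q)%N by rewrite expn_gt0 prime_gt0.
have qR : 0 < q%:R :> R by rewrite ltr0n.
have -> : \sum_(1 <= m < (N %/ q).+1) F (q * m)%N = F q * chi3_sum R (N %/ q).
  rewrite mulr_sumr; apply: eq_bigr => m _.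
  by rewrite /F chi3M natrM rmorphM/= invfM; ring.
have lp : 0 <= ln p%:R :> R by rewrite ln_ge0// ler1n prime_gt0.
case: leqP => [qN|Nq]; last first.
  by rewrite divn_small// /chi3_sum big_geq// !mulr0 subr0 normr0.
(* The partial sum up to [N/q] differs from [L] by at most the inverse of [N %/ q + 1]. With the
   factor [1/q] this is at most [1/N], so each prime power costs [ln p / N] and the total is
   [psi(N) / N]. *)
rewrite [X in `|X|](_ : _ = - (ln p%:R * (F q * (L - chi3_sum R (N %/ q))))).
  rewrite normrN normrM (ger0_norm lp) ler_wpM2l// normrM.
  apply: (@le_trans _ _ (q%:R^-1 * (N %/ q).+1%:R^-1)); last first.
    rewrite -invfM lef_pV2 ?posrE ?mulr_gt0// ?ltr0n// -natrM ler_nat mulnC.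
    by rewrite ltnW// ltn_ceil.
  rewrite ler_pM ?lim_chi3_sum_tail//.
  rewrite /F normrM normfV (ger0_norm (ltW qR)) ler_piMl ?invr_ge0 ?(ltW qR)//.
  exact: norm_chi3_le1.
by rewrite /F; ring.
Qed.

Lemma sum_geo_tail_le (R : realFieldType) (q : R) (M : nat) : 1 < q ->
  \sum_(2 <= k < M) q ^- k <= (q * (q - 1))^-1.
Proof.
move=> q1; have q0 : 0 < q by lra.
have q10 : 0 < q - 1 by lra.
case: M => [|[|M]]; try by rewrite big_geq// invr_ge0 mulr_ge0// ltW.
have -> : \sum_(2 <= k < M.+2) q ^- k = (q^-1 - q ^- M.+1) / (q - 1).
  elim: M => [|M IH]; first by rewrite big_geq// expr1 subrr mul0r.
  rewrite big_nat_recr//= IH [q ^+ M.+2]exprS invfM.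
  by field; rewrite expf_neq0 !gt_eqF.
rewrite invfM ler_wpM2r ?invr_ge0 ?(ltW q10)// gerBl invr_ge0 exprn_ge0//.
exact: ltW.
Qed.

Lemma sum_ln_div_sq_le (R : realType) (M : nat) :
  \sum_(1 <= n < M) ln n.+1%:R / (n.+1%:R * n%:R) <= 2 :> R.
Proof.
case: M => [|M]; first by rewrite big_geq.
(* Telescoping majorant with [H 1 = 2]. A primitive of [ln x / x^2] is [- (ln x + 1) / x]; the
   constant 2 in place of 1 leaves room for the error in [ln (n+1) <= ln n + 1/n]. *)
pose H n : R := (ln n%:R + 2) / n%:R.
apply: (@le_trans _ _ (\sum_(1 <= n < M.+1) (- H n.+1 - - H n))).
  apply: ler_sum_nat => n /andP[n1 _].
  have h := ln_succ_le R n1.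
  have nR : 1 <= n%:R :> R by rewrite ler1n.
  rewrite /H -natr1; set x := n%:R : R; rewrite -/x -natr1 -/x in nR h.
  set y := x^-1 in h *.
  rewrite opprK [leRHS]addrC -subr_ge0.
  have -> : (ln x + 2) * y - (ln (x + 1) + 2) / (x + 1) - ln (x + 1) / ((x + 1) * x)
    = ((ln x + y - ln (x + 1)) * (x + 1) * x + (x - 1)) / ((x + 1) * x * x).
    by rewrite /y; field; lra.
  rewrite divr_ge0//; last by rewrite !mulr_ge0//; lra.
  apply: addr_ge0; last by lra.
  by apply: mulr_ge0; [apply: mulr_ge0|]; lra.
rewrite telescope_sumr// opprK {2}/H ln1 add0r divr1 gerDr oppr_le0.
by rewrite divr_ge0// addr_ge0// ln_ge0// ler1n.
Qed.

(** Discarding the prime powers with [k >= 2] costs at most the sum of [ln p / (p (p - 1))], which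
    is bounded by the same sum over all integers from 2 on. *)
Lemma chi3_prime_ln_sum_le (R : realType) : exists B : R, forall N, (3 <= N)%N ->
  `|\sum_(0 <= p < N.+1 | prime p) ln p%:R * ((chi3 p)%:~R / p%:R)| <= B.
Proof.
have [B HB] := chi3_mangoldt_sum_le R; exists (B + 2) => N N3.
have := HB N N3; set W := \sum_(_ <= p < _ | _) _ => WB.
set V := \sum_(_ <= p < _ | _) _.
suff WV : `|W - V| <= 2.
  rewrite -[V](subKr W) (le_trans (ler_normB _ _))// lerD//.
have -> : V = \sum_(0 <= p < N.+2 | prime p)
    if (p <= N)%N then ln p%:R * ((chi3 p)%:~R / p%:R) else 0.
  by rewrite -big_mkcondr/= /V (@big_nat_widen _ _ _ _ N.+1 N.+2).
pose G p : R := ln p%:R / (p%:R * p.-1%:R).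
have G0 p : 0 <= G p.
  case: p => [|p]; first by rewrite /G mul0r invr0 mulr0.
  by rewrite divr_ge0// ?mulr_ge0// ln_ge0// ler1n.
apply: le_trans (sum_ln_div_sq_le R N.+1).
have -> : \sum_(1 <= n < N.+1) ln n.+1%:R / (n.+1%:R * n%:R) =
    \sum_(2 <= p < N.+2) G p :> R by rewrite [RHS]big_add1.
apply: (@le_trans _ _ (\sum_(0 <= p < N.+2 | prime p) G p)); last first.
  rewrite big_mkcond big_ltn//= add0r big_ltn//= add0r.
  by apply: ler_sum => p _; case: ifP.
rewrite /W -sumrB (le_trans (ler_norm_sum _ _ _))//; apply: ler_sum => p pp.
have p1 : 1 < p%:R :> R by rewrite ltr1n prime_gt1.
have lp : 0 <= ln p%:R :> R by rewrite ln_ge0// ltW.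
rewrite big_mkcond big_ltn//= expn1 addrAC subrr add0r.
rewrite (le_trans (ler_norm_sum _ _ _))//.
have -> : G p = ln p%:R * (p%:R * (p%:R - 1))^-1.
  by rewrite /G -subn1 natrB// prime_gt0.
apply: le_trans (ler_wpM2l lp (sum_geo_tail_le N.+2 p1)).
rewrite mulr_sumr; apply: ler_sum => k _; case: ifP => _; last first.
  by rewrite normr0 mulr_ge0// invr_ge0 exprn_ge0// ltW// (lt_trans _ p1).
rewrite normrM (ger0_norm lp) ler_wpM2l// normrM natrX -[leRHS]mul1r.
rewrite ler_pM ?norm_chi3_le1// ger0_norm// invr_ge0 exprn_ge0//.
Qed.

(** Summation by parts against [1 / ln p]. A block sum is a difference of two initial sums, hence
    the constant [B + B]; starting at 4 keeps the logarithms positive. *)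
Lemma chi3_prime_sum_tail (R : realType) : exists2 C : R, 0 <= C &
  forall m n, (4 <= m <= n)%N ->
  `|\sum_(m <= p < n | prime p) (chi3 p)%:~R / p%:R| <= C / ln m%:R.
Proof.
have [B HB] := chi3_prime_ln_sum_le R; exists (B + B).
  by have := le_trans (normr_ge0 _) (HB _ (leqnn 3)); lra.
move=> m n /andP[m4 mn].
have ln0 i : (m <= i)%N -> 0 < ln i%:R :> R.
  by move=> mi; rewrite (lt_le_trans _ (ln_ge1 _))// ler_nat; lia.
pose b p : R := if prime p then ln p%:R * ((chi3 p)%:~R / p%:R) else 0.
rewrite big_mkcond/=.
rewrite (_ : \sum_(_ <= _ < _) _ = \sum_(m <= p < n) b p * (ln p%:R)^-1); last first.
  apply: eq_big_nat => p /andP[mp _]; rewrite /b; case: ifP => _.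
    by have := ln0 p mp => lp; rewrite mulrAC divff ?mul1r// gt_eqF.
  by rewrite mul0r.
apply: (@abel_sum_le _ (fun p : nat => (ln p%:R)^-1)) => //.
- move=> i /andP[mi _]; rewrite lef_pV2 ?posrE ?ln0//; last by lia.
  by rewrite ler_ln ?posrE ?ltr0n ?ler_nat//; lia.
- by move=> i /andP[mi _]; rewrite invr_ge0 ltW// ln0.
- move=> k /andP[mk _]; rewrite /b -big_mkcond/=.
  have m1 : m.-1.+1 = m by lia.
  have k1 : k.-1.+1 = k by lia.
  have := HB m.-1; have := HB k.-1; rewrite m1 k1.
  move=> /(_ ltac:(lia)) hk /(_ ltac:(lia)) hm.
  move: hk; rewrite (big_cat_nat (n := m))//=.
  set S := \sum_(_ <= i < m | _) _ in hm *; set T := \sum_(_ <= i < _ | _) _ => hk.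
  by rewrite -[T](addKr S) addrC (le_trans (ler_normB _ _))// lerD.
Qed.

(** * Convergence of the Euler product *)

Lemma ln_1B_approx (R : realType) (x : R) : `|x| <= 1 / 2 ->
  `|ln (1 - x) + x| <= 2 * x ^+ 2.
Proof.
rewrite ler_norml => /andP[x1 x2].
have h1 : ln (1 + - x) <= - x by apply: le_ln1Dx; lra.
(* The lower bound also comes from [ln (1 + t) <= t], at the [t] with [1 + t = 1 / (1 - x)]. *)
have h2 : ln (1 + x / (1 - x)) <= x / (1 - x).
  by apply: le_ln1Dx; rewrite ltr_pdivlMr; lra.
have e : 1 + x / (1 - x) = (1 - x)^-1 by field; lra.
rewrite e lnV ?posrE in h2; last by lra.
have h3 : x / (1 - x) - x <= 2 * x ^+ 2.
  rewrite lerBlDr ler_pdivrMr; last by lra.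
  have := sqr_ge0 x; rewrite expr2; nra.
by rewrite ler_norml; have s := sqr_ge0 x; apply/andP; split; lra.
Qed.

(** Each logarithm is [- chi(p) / p] up to [5 / (p (p - 1))]: 4 comes from the quadratic error of
    the logarithm, 1 from replacing [p - 1] by [p]. These errors telescope to at most
    [5 / (m - 1) <= 5 / ln m]. The predicate [Q] removes finitely many primes, all below [K]. *)
Lemma chi3_log_sum_tail (R : realType) (Q : pred nat) (K : nat) :
  (forall n, (K <= n)%N -> Q n) -> exists C : R, forall m n,
  (maxn 4 K <= m <= n)%N ->
  `|\sum_(m <= p < n | prime p && Q p)
     ln (1 - (chi3 p)%:~R / (p%:R - 1))| <= C / ln m%:R.
Proof.
move=> QK; have [C C0 HC] := chi3_prime_sum_tail R; exists (C + 5) => m n.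
move=> /andP[m4K mn]; have m4 : (4 <= m)%N by lia.
have mR : 4 <= m%:R :> R by rewrite ler_nat.
have lm : 1 <= ln m%:R :> R by exact: ln_ge1.
have -> : \sum_(m <= p < n | prime p && Q p) ln (1 - (chi3 p)%:~R / (p%:R - 1))
    = \sum_(m <= p < n | prime p) ln (1 - (chi3 p)%:~R / (p%:R - 1)) :> R.
  rewrite [LHS]big_nat_cond [RHS]big_nat_cond; apply: eq_bigl => p.
  apply: andb_id2l => mp; rewrite QK ?andbT//; lia.
set U := \sum_(_ <= _ < _ | _) _.
pose V : R := \sum_(m <= p < n | prime p) (chi3 p)%:~R / p%:R.
have hV : `|V| <= C / ln m%:R by apply: HC; rewrite m4.
suff H : `|U + V| <= 5 / (m%:R - 1).
  rewrite -[U](addrK V) (le_trans (ler_normB _ _))// [leRHS]mulrDl addrC lerD//.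
  apply: (le_trans H); rewrite ler_wpM2l// lef_pV2 ?posrE; [|lra|lra].
  have := @le_ln1Dx R (m%:R - 1); rewrite subrKC; lra.
rewrite /U /V -big_split/= (le_trans (ler_norm_sum _ _ _))//.
apply: (@le_trans _ _ (\sum_(m <= p < n)
    (- (5 / (p.+1%:R - 1)) - - (5 / (p%:R - 1))))); last first.
  rewrite telescope_sumr// opprK gerDr oppr_le0 divr_ge0// subr_ge0 ler1n; lia.
rewrite big_mkcond/=; apply: ler_sum_nat => p /andP[mp _].
have pR : 4 <= p%:R :> R by rewrite ler_nat; lia.
have -> : - (5 / (p.+1%:R - 1)) - - (5 / (p%:R - 1)) = 5 / (p%:R * (p%:R - 1)) :> R.
  by rewrite -[p.+1%:R]natr1 addrK; field; lra.
case: ifP => _; last by rewrite divr_ge0// mulr_ge0//; lra.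
have : `|(chi3 p)%:~R : R| <= 1 by exact: norm_chi3_le1.
set c := (chi3 p)%:~R : R; set y := p%:R : R in pR * => c1.
have xb : `|c / (y - 1)| <= (y - 1)^-1.
  rewrite normrM normfV [X in _ / X]ger0_norm; last by lra.
  by rewrite ler_piMl// invr_ge0; lra.
have y3 : (y - 1)^-1 <= 1 / 2.
  by rewrite -[_^-1]mul1r ler_pdivrMr; lra.
have h := ln_1B_approx (le_trans xb y3).
have -> : ln (1 - c / (y - 1)) + c / y
    = ln (1 - c / (y - 1)) + c / (y - 1) - (c / (y - 1) - c / y) by ring.
rewrite (le_trans (ler_normB _ _))//.
have -> : 5 / (y * (y - 1)) = 4 / (y * (y - 1)) + 1 / (y * (y - 1)).
  by field; lra.
rewrite lerD//.
  apply: (le_trans h); rewrite -real_normK ?num_real//.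
  apply: (@le_trans _ _ (2 * (y - 1) ^- 2)).
    by rewrite ler_wpM2l// -exprVn lerXn2r// nnegrE invr_ge0; lra.
  rewrite -subr_ge0 (_ : _ - _ = 2 * (y - 2) / (y * (y - 1) ^+ 2)); last first.
    by field; lra.
  by rewrite divr_ge0 ?mulr_ge0 ?sqr_ge0//; lra.
have -> : c / (y - 1) - c / y = c / (y * (y - 1)) by field; lra.
have yy : 0 < y * (y - 1) by rewrite mulr_gt0//; lra.
by rewrite normrM normfV (ger0_norm (ltW yy)) ler_wpM2r// invr_ge0 ltW.
Qed.

Lemma cvg_inv_ln (R : realType) : ((ln n%:R)^-1 @[n --> \oo] --> (0 : R)).
Proof.
apply/cvgr0Pnorm_lt => e e0.
near=> n.
have ne : expR e^-1 < n%:R :> R.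
  by near: n; exact: nbhs_infty_gtr.
have ln_e : e^-1 < ln n%:R.
  rewrite -[e^-1]expRK ltr_ln ?posrE ?expR_gt0//.
  by rewrite (lt_trans _ ne) ?expR_gt0.
have ln0 : 0 < ln n%:R :> R by rewrite (lt_trans _ ln_e)// invr_gt0.
by rewrite ger0_norm ?invr_ge0 ?(ltW ln0)// -[e]invrK ltf_pV2 ?posrE ?invr_gt0.
Unshelve. all: by end_near.
Qed.

Lemma chi3_prod_neq0 (R : realType) (Q : pred nat) (K : nat) :
  ~~ Q 2%N -> (forall n, (K <= n)%N -> Q n) ->
  lim ((fun n => \prod_(p < n | prime p && Q p)
         (1 - (chi3 p)%:~R / (p%:R - 1) : R)) @ \oo) != 0.
Proof.
move=> Q2 QK.
pose U n : R := \sum_(0 <= p < n | prime p && Q p) ln (1 - (chi3 p)%:~R / (p%:R - 1)).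
have cU : cvgn U.
  have [C HC] := chi3_log_sum_tail R QK.
  apply: (@cvgn_tail_le R _ (fun m => C / ln m%:R) (maxn 4 K)).
    rewrite -[X in _ --> X](mulr0 C); apply: cvgM; first exact: cvg_cst.
    exact: cvg_inv_ln.
  move=> m n mn; rewrite /U (big_cat_nat (n := m))//=; last by lia.
  by rewrite addrAC subrr add0r HC.
have -> : (fun n => \prod_(p < n | prime p && Q p)
    (1 - (chi3 p)%:~R / (p%:R - 1))) = expR \o U.
  apply/funext => n /=; rewrite /U expR_sum big_mkord.
  apply: eq_bigr => p /andP[pp Qp]; rewrite lnK// posrE subr_gt0.
  (* With 2 excluded, [chi(p) / (p - 1)] is at most [1/2], so every factor is positive and is the
     exponential of its logarithm. *)
  have p3 : (3 <= p)%N.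
    by have := prime_gt1 pp; rewrite leq_eqVlt => /orP[/eqP p2|//]; rewrite p2 Qp in Q2.
  have pR : 3 <= (p : nat)%:R :> R by rewrite (ler_nat R 3).
  rewrite ltr_pdivrMr; last by lra.
  have := norm_chi3_le1 R p; rewrite ler_norml => /andP[_]; lra.
have : expR (U n) @[n --> \oo] --> expR (limn U).
  by apply: continuous_cvg => //; exact: continuous_expR.
by move=> /cvg_lim -> //; rewrite gt_eqF// expR_gt0.
Qed.

(** * Quadratic symbols *)

Lemma Fp_fermat (p : nat) (x : 'F_p) : prime p -> x != 0 -> x ^+ p.-1 = 1.
Proof.
move=> pp x0; apply: (mulfI x0); rewrite -exprS prednK ?prime_gt0// mulr1.
by have := expf_card x; rewrite card_Fp.
Qed.

Lemma Fp_primitive_root (p : nat) : prime p ->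
  exists z : 'F_p, p.-1.-primitive_root z.
Proof.
move=> pp; suff /hasP[z _] : has p.-1.-primitive_root (enum (predC1 (0 : 'F_p))).
  by exists z.
apply: has_prim_root; first by have := prime_gt1 pp; lia.
- apply/allP => x; rewrite mem_enum inE => x0; apply/unity_rootP.
  exact: Fp_fermat.
- exact: enum_uniq.
- by rewrite -cardE cardC1 card_Fp.
Qed.

(** Euler's criterion: if [a = z^i] with [z] a primitive root, the power is 1 exactly when [p - 1]
    divides [i (p - 1) / 2], that is when [i] is even. *)
Lemma Fp_expf_half_eq1 (p : nat) (a : 'F_p) : prime p -> odd p -> a != 0 ->
  (a ^+ p.-1./2 == 1) = [exists y : 'F_p, y ^+ 2 == a].
Proof.
move=> pp op a0.
have p2 : p.-1 = (p.-1./2 * 2)%N by rewrite muln2 halfK; have := prime_gt0 pp; lia.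
have h0 : (0 < p.-1)%N by have := prime_gt1 pp; lia.
apply/eqP/existsP => [ah|[y /eqP ya]]; last first.
  rewrite -ya -exprM mulnC -p2 Fp_fermat//.
  by apply: contraNneq a0 => y0; rewrite -ya y0 expr0n.
have [z zprim] := Fp_primitive_root pp.
have [i ai] := prim_rootP zprim (Fp_fermat pp a0).
move: ah; rewrite ai -exprM => /eqP; rewrite -(prim_order_dvd zprim).
rewrite {1}p2 mulnC dvdn_pmul2r; last by lia.
by move=> i2; exists (z ^+ (i %/ 2)); rewrite -exprM divnK// -ai.
Qed.

Lemma legendre_exists_Fp (a : int) (p : nat) : prime p ->
  [exists x : 'I_p, (a == (x : nat)%:Z ^+ 2 %[mod p%:Z])%Z] =
  [exists y : 'F_p, y ^+ 2 == a%:~R].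
Proof.
move=> pp; have pchar := pchar_Fp pp.
apply/existsP/existsP => -[x].
    rewrite eqz_mod_dvd (dvdz_pcharf pchar) rmorphB rmorphXn/= subr_eq0 => /eqP e.
    by exists x%:R; rewrite e.
  move=> /eqP e.
  have xp : (x < p)%N by rewrite -[X in (_ < X)%N](Fp_cast pp).
  exists (Ordinal xp); rewrite eqz_mod_dvd (dvdz_pcharf pchar) rmorphB rmorphXn/=.
  by rewrite -e subr_eq0 -[(nat_of_ord x)%:~R]/(x%:R) natr_Zp.
Qed.

Lemma legendre_Fp (a : int) (p : nat) : prime p -> odd p ->
  (legendre a p)%:~R = a%:~R ^+ p.-1./2 :> 'F_p.
Proof.
move=> pp op; have pchar := pchar_Fp pp.
rewrite /legendre (dvdz_pcharf pchar).
case: eqP => [->|/eqP a0].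
  rewrite expr0n; case: eqP => //.
  have := prime_gt1 pp; move: op; lia.
rewrite legendre_exists_Fp//.
rewrite -Fp_expf_half_eq1//; case: eqP => [->//|/eqP ah].
have : (a%:~R ^+ p.-1./2) ^+ 2 == 1 :> 'F_p.
  rewrite -exprM muln2 halfK.
  have -> : (p.-1 - odd p.-1)%N = p.-1 by have := prime_gt0 pp; lia.
  by rewrite Fp_fermat.
by rewrite sqrf_eq1 (negbTE ah)/= => /eqP ->; rewrite rmorphN.
Qed.

Lemma sign_Fp_inj (p : nat) (a b : int) : prime p -> odd p ->
  (a == 1) || (a == -1) -> (b == 1) || (b == -1) ->
  a%:~R = b%:~R :> 'F_p -> a = b.
Proof.
move=> pp op ha hb.
move=> /eqP; rewrite -subr_eq0 -rmorphB/= -(dvdz_pcharf (pchar_Fp pp)).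
have p3 : (3 <= p)%N by have := prime_gt1 pp; move: op; lia.
by move: ha hb => /orP[]/eqP-> /orP[]/eqP->//; rewrite dvdzE/= => /dvdn_leq; lia.
Qed.

Lemma legendre_sign (a : int) (p : nat) : ~~ (p%:Z %| a)%Z ->
  (legendre a p == 1) || (legendre a p == -1).
Proof. by rewrite /legendre => /negbTE ->; case: ifP. Qed.

Lemma chi3_sign (n : nat) : ~~ (3 %| n)%N -> chi3 n = 1 \/ chi3 n = -1.
Proof. by rewrite /chi3; do ?[case: ifP => ?]; lia. Qed.

Lemma prime_ndvdz_neg3 (p : nat) : prime p -> p != 3%N -> ~~ (p%:Z %| (-3)%R)%Z.
Proof.
by move=> pp p3; rewrite dvdzE/= dvdn_prime2.
Qed.

(* A root [y] of [y^2 = -3] corresponds to the root [(y - 1) / 2] of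
   [x^2 + x + 1], that is, to an element of order 3. *)
Lemma legendre_neg3 (p : nat) : prime p -> odd p -> legendre (-3) p = chi3 p.
Proof.
move=> pp op; have [->|p3] := eqVneq p 3%N; first by [].
have np3 := prime_ndvdz_neg3 pp p3.
have p2 : (2 < p)%N by have := prime_gt1 pp; move: op; lia.
have n3p : ~~ (3 %| p)%N by rewrite dvdn_prime2// eq_sym.
have ne3 : (3 : 'F_p) != 0.
  by have := np3; rewrite (dvdz_pcharf (pchar_Fp pp)) mulrNz oppr_eq0.
have ne2 : (2 : 'F_p) != 0.
  rewrite -(dvdn_pcharf (pchar_Fp pp)); apply/negP => /dvdn_leq; lia.
suff : (legendre (-3) p == 1) = (chi3 p == 1).
  have := legendre_sign np3; have := chi3_sign n3p.
  by move=> [->|->] /orP[]/eqP->.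
have chi1 : (chi3 p == 1) = (3 %| p.-1)%N.
  rewrite /chi3; case: ifP; first by lia.
  by case: ifP; have := prime_gt0 pp; lia.
have -> : (legendre (-3) p == 1) = [exists y : 'F_p, y ^+ 2 == (-3)%:~R].
  by rewrite /legendre (negbTE np3) legendre_exists_Fp//; case: ifP.
rewrite mulrNz chi1; apply/existsP/idP => [[y /eqP y3]|/dvdnP[k pk]].
  pose w := (y - 1) / 2.
  have w0 : w ^+ 2 + w + 1 = 0.
    have wy : 2 * w + 1 = y by rewrite /w mulrC divfK// subrK.
    apply: (mulfI ne2); apply: (mulfI ne2); rewrite !mulr0.
    have -> : 2 * (2 * (w ^+ 2 + w + 1)) = (2 * w + 1) ^+ 2 + 3 by ring.
    by rewrite wy y3 addNr.
  have w3 : w ^+ 3 = 1.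
    apply/eqP; rewrite -subr_eq0.
    have -> : w ^+ 3 - 1 = (w - 1) * (w ^+ 2 + w + 1) by ring.
    by rewrite w0 mulr0.
  have w1 : w != 1.
    by apply: contraNneq ne3 => w1; rewrite -w0 w1; apply/eqP; ring.
  have w00 : w != 0.
    by apply: contra_eq_neq w0 => ->; rewrite expr0n !add0r oner_neq0.
  have : w ^+ (p.-1 %% 3) = 1.
    have := Fp_fermat pp w00; rewrite {1}(divn_eq p.-1 3) exprD mulnC exprM w3.
    by rewrite expr1n mul1r.
  have : (p.-1 %% 3 < 3)%N by rewrite ltn_mod.
  rewrite /dvdn; case: (p.-1 %% 3)%N => [|[|[|]]]// _.
    by rewrite expr1 => e; rewrite e eqxx in w1.
  by move=> e; move: w3; rewrite exprS e mulr1 => e1; rewrite e1 eqxx in w1.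
have k0 : (0 < k)%N by lia.
have [z zprim] := Fp_primitive_root pp.
pose w := z ^+ k.
have w3 : w ^+ 3 = 1 by rewrite -exprM -pk; exact: prim_expr_order.
have w1 : w != 1.
  by rewrite -(prim_order_dvd zprim) pk gtnNdvd//; lia.
have w0 : w ^+ 2 + w + 1 = 0.
  have : (w - 1) * (w ^+ 2 + w + 1) = 0.
    have -> : (w - 1) * (w ^+ 2 + w + 1) = w ^+ 3 - 1 by ring.
    by rewrite w3 subrr.
  by move=> /eqP; rewrite mulf_eq0 subr_eq0 (negbTE w1)/= => /eqP.
exists (2 * w + 1); apply/eqP.
have -> : (2 * w + 1) ^+ 2 = 4 * (w ^+ 2 + w + 1) - 3 by ring.
by rewrite w0 mulr0 add0r.
Qed.

(** The even quadratic character of conductor 12; on integers prime to 6 it is the symbol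
    [(3/n)]. *)
Definition chi12 (n : nat) : int :=
  if (n %% 12)%N \in [:: 1%N; 11%N] then 1
  else if (n %% 12)%N \in [:: 5%N; 7%N] then -1 else 0.

Lemma coprime6 (n : nat) : coprime n 6 -> odd n /\ ~~ (3 %| n)%N.
Proof.
rewrite (coprimeMr n 2 3) coprimen2 coprime_sym.
by rewrite prime_coprime// => /andP[].
Qed.

Lemma chi12M (m n : nat) : chi12 (m * n) = chi12 m * chi12 n.
Proof.
have tbl : all (fun i => all (fun j => chi12 (i * j) == chi12 i * chi12 j)
  (iota 0 12)) (iota 0 12) by [].
have chi12_mod k : chi12 (k %% 12) = chi12 k by rewrite /chi12 modn_mod.
rewrite -chi12_mod -modnMml -modnMmr chi12_mod -[chi12 m]chi12_mod -[chi12 n]chi12_mod.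
have h k : (k %% 12)%N \in iota 0 12 by rewrite mem_iota ltn_mod.
by move/allP: tbl => /(_ _ (h m)) /allP /(_ _ (h n)) /eqP.
Qed.

(** The factorization [(3/n) = (-1/n) (-3/n)]. It reduces the symbol at 3 to the one at -3, and
    later cancels the sign in [varsigma2]. *)
Lemma chi12E (n : nat) : odd n -> ~~ (3 %| n)%N ->
  chi12 n = (-1) ^+ ((n - 1) %/ 2) * chi3 n.
Proof.
move=> on n3; rewrite -signr_odd /chi12 /chi3 !inE.
case: (boolP (odd ((n - 1) %/ 2))) => h; rewrite ?expr0 ?expr1 ?mul1r ?mulN1r;
  do ?[case: ifP => ?]; lia.
Qed.

(** Both sides are signs, so they may be compared in ['F_p], where Euler's criterion turns the
    symbols at 3 and -3 into powers differing by [(-1)^((p-1)/2)]. Quadratic reciprocity is not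
    invoked. *)
Lemma legendre3 (p : nat) : prime p -> (3 < p)%N -> legendre 3 p = chi12 p.
Proof.
move=> pp p3.
have op : odd p by case: (even_prime pp) => // p2; lia.
have n3p : ~~ (3 %| p)%N by rewrite dvdn_prime2//; lia.
have n3 : ~~ (p%:Z %| (3)%R)%Z by rewrite dvdzE/= dvdn_prime2//; lia.
apply: (sign_Fp_inj pp op (legendre_sign n3)).
  rewrite /chi12 !inE; case: ifP => // h1; case: ifP => // h2; lia.
have := legendre_Fp (-3) pp op; rewrite legendre_neg3// mulrNz exprNn => e.
have h : ((p - 1) %/ 2 = p.-1./2)%N by lia.
rewrite chi12E// h legendre_Fp// rmorphM/= e rmorphXn/= mulrA -exprMn rmorphN1
  mulrNN mulr1.
by rewrite expr1n mul1r.
Qed.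

Lemma jacobi3 (n : nat) : coprime n 6 -> (0 < n)%N -> jacobi 3 n = chi12 n.
Proof.
move=> n6 n0; rewrite [in RHS](prod_prime_decomp n0) prime_decompE big_map/=.
have chi12X k m : chi12 (m ^ k) = chi12 m ^+ k.
  by elim: k => // k IH; rewrite expnS chi12M IH exprS.
rewrite (big_morph chi12 chi12M (erefl : chi12 1 = 1)) /jacobi !big_seq.
apply: eq_bigr => p; rewrite mem_primes => /and3P[pp _ pn].
rewrite chi12X legendre3//.
have := coprime_dvdl pn n6; case: p pp {pn} => [|[|[|[|]]]]//.
Qed.

Lemma legendre_mod3 (a : int) : legendre a 3 =
  if (a == 0 %[mod 3])%Z then 0 else if (a == 1 %[mod 3])%Z then 1 else -1.
Proof.
rewrite /legendre.
have -> : [exists x : 'I_3, (a == (x : nat)%:Z ^+ 2 %[mod 3%:Z])%Z] =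
    (a == 0 %[mod 3])%Z || (a == 1 %[mod 3])%Z.
  apply/existsP/orP => [[[[|[|[|//]]] i] /= h]|[h|h]].
  - by left.
  - by right.
  - by right.
  - by exists ord0.
  - by exists (Ordinal (isT : (1 < 3)%N)).
by do ?[case: ifP => ?] => //; lia.
Qed.

(** * Vanishing in terms of the signs *)

Lemma h3_neq0 (R : realType) (r : int) : r != 0 -> h3 R r != 0.
Proof.
move=> r0; rewrite /h3 !mulf_neq0 ?invr_eq0//.
  by case: ifP; rewrite ?oner_neq0.
pose Q p := ~~ (p%:Z %| 2 * r)%Z.
have -> : (fun n => \prod_(p < n | prime p && ~~ ((p : nat)%:Z %| 2 * r)%Z)
    (1 - (legendre (-3) p)%:~R / (p%:R - 1) : R)) =
  (fun n => \prod_(p < n | prime p && Q p) (1 - (chi3 p)%:~R / (p%:R - 1) : R)).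
  apply/funext => n; apply: eq_bigr => p /andP[pp pr].
  rewrite legendre_neg3//; case: (even_prime pp) => // p2.
  by rewrite p2 dvdz_mulr in pr.
(* No integer above [|2r|] divides the nonzero integer [2r]. *)
apply: (@chi3_prod_neq0 R Q (absz (2 * r)).+1); first by rewrite /Q dvdz_mulr.
move=> n rn; rewrite /Q dvdzE/=; apply/negP => /dvdn_leq.
by rewrite absz_gt0 mulf_neq0// => /(_ isT); rewrite leqNgt rn.
Qed.

Definition weight (R : realType) (p : nat) : R :=
  -1 / (p%:R - 1 - (legendre (-3) p)%:~R).

(** The denominator is [p - 1 - chi(p)]: [4 + 1] at 5, [6 - 1] at 7, and at least 9 from 11 on. *)
Lemma weight_small (R : realType) (p : nat) : prime p -> (3 < p)%N ->
  if (p == 5%N) || (p == 7%N) then weight R p = - (1 / 5)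
  else `|weight R p| < 1 / 5.
Proof.
move=> pp p3; rewrite /weight legendre_neg3//; last first.
  by case: (even_prime pp) => // p2; lia.
case: eqP => [->/=|p5]; first by rewrite /chi3/= rmorphN; field.
case: eqP => [->/=|p7]; first by rewrite /chi3/=; field.
have p11 : (11 <= p)%N by case: p pp p3 p5 p7 => [|[|[|[|[|[|[|[|[|[|[|]]]]]]]]]]].
have pR : 11 <= p%:R :> R by rewrite ler_nat.
have := norm_chi3_le1 R p; set c := _%:~R; rewrite ler_norml => /andP[c1 c2].
rewrite /= normrM normrN normr1 mul1r normfV ger0_norm; last by lra.
by rewrite ?div1r ltf_pV2 ?posrE; lra.
Qed.

Lemma weight_le (R : realType) (p : nat) : prime p -> (3 < p)%N ->
  `|weight R p| <= 1 / 5.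
Proof.
move=> pp p3; have := weight_small R pp p3; case: ifP => _; last exact: ltW.
by move=> ->; rewrite normrN ger0_norm.
Qed.

Lemma norm_prod_weight_le1 (R : realType) (s : seq nat) :
  (forall p, p \in s -> prime p /\ (3 < p)%N) ->
  `|\prod_(p <- s) weight R p| <= 1.
Proof.
elim: s => [|p s IH] hs; first by rewrite big_nil normr1.
have [pp p3] := hs p (mem_head _ _).
rewrite big_cons normrM -[leRHS]mulr1 ler_pM//.
  by apply: (le_trans (weight_le R pp p3)); lra.
by apply: IH => i si; apply: hs; rewrite inE si orbT.
Qed.

(** Two or more factors give at most [1/25] in absolute value, so only a single factor can reach
    [- 1/5]. *)
Lemma prod_weight_le (R : realType) (s : seq nat) :
  (forall p, p \in s -> prime p /\ (3 < p)%N) -> s != [::] ->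
  `|\prod_(p <- s) weight R p| <= 1 / 5 /\
  (\prod_(p <- s) weight R p = - (1 / 5) <-> (s = [:: 5%N] \/ s = [:: 7%N])).
Proof.
case: s => // p s hs _; have [pp p3] := hs p (mem_head _ _).
have wp := weight_le R pp p3.
case: s hs => [|q s] hs.
  rewrite big_seq1; split=> //; have := weight_small R pp p3.
  case: ifP => [|/norP[p5 p7] w]; first by move=> /orP[]/eqP-> ->; split; auto.
  split=> [e|[[e]|[e]]]; last 2 first.
  - by rewrite e in p5.
  - by rewrite e in p7.
  by move: w; rewrite e normrN ger0_norm ?ltxx.
have hq : `|\prod_(i <- q :: s) weight R i| <= 1 / 5.
  have [|qq q3] := hs q; first by rewrite !inE eqxx orbT.
  rewrite big_cons normrM -[leRHS]mulr1 ler_pM ?weight_le//.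
  by apply: norm_prod_weight_le1 => i si; apply: hs; rewrite !inE si !orbT.
have h : `|\prod_(i <- [:: p, q & s]) weight R i| <= 1 / 5 * (1 / 5).
  by rewrite big_cons normrM ler_pM.
split; first by apply: (le_trans h); lra.
split=> [e|[]//]; exfalso; move: h; rewrite e normrN ger0_norm//; lra.
Qed.

Lemma varpi_algebra (R : realFieldType) (s T x y z : R) :
  [\/ s = 0, s = 1 | s = -1] -> [\/ T = 0, T = 2 | T = -1] ->
  (x = 1 \/ `|x| <= 1 / 5) -> (y = 1 \/ `|y| <= 1 / 5) ->
  (z = 1 \/ `|z| <= 1 / 5) ->
  1 + s * (x * z) + T * (y * z + s * (x * y * z)) = 0 <->
  [\/ [/\ s = 1, T = 2, x = 1, y = 1 & z = - (1 / 5)],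
      [/\ s = -1, x = 1 & z = 1] | [/\ T = -1, y = 1 & z = 1]].
Proof.
move=> hs hT hx hy hz; split; last first.
  by move=> [[-> -> -> -> ->]|[-> -> ->]|[-> -> ->]]; field.
have [z1|z5] := hz.
  rewrite z1 (_ : _ + _ = (1 + s * x) * (1 + T * y)); last by ring.
  move=> /eqP; rewrite mulf_eq0 => /orP[]/eqP e.
    apply: Or32; move: e hx; case: hs => ->; rewrite ?ler_norml;
      by move=> e [x1|/andP[x1 x2]]; split=> //; lra.
  apply: Or33; move: e hy; case: hT => ->; rewrite ?ler_norml;
    by move=> e [y1|/andP[y1 y2]]; split=> //; lra.
have le1 (u : R) : (u = 1 \/ `|u| <= 1 / 5) -> `|u| <= 1.
  by move=> [->|?]; rewrite ?normr1//; lra.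
have mul_le (a b : R) : (a = 1 \/ `|a| <= 1 / 5) -> `|b| <= 1 / 5 -> `|a * b| <= 1 / 5.
  by move=> /le1 a1 b1; rewrite normrM -[leRHS]mul1r ler_pM.
have u5 := mul_le _ _ hx z5; have v5 := mul_le _ _ hy z5.
have t5 := mul_le _ _ hy u5.
rewrite (_ : x * y * z = y * (x * z)); last by ring.
move: u5 v5 t5; rewrite !ler_norml => /andP[u1 u2] /andP[v1 v2] /andP[t1 t2] e.
(* The three terms are at most [1/5], [2/5] and [2/5] in absolute value. Their sum is -1 only if all
   three are extremal, which fixes the values of [x z], [y z] and [x y z]. *)
have [s1 T2] : s <> 0 /\ T = 2.
  by split=> [s0|]; case: hT => hT; move: e; rewrite hT ?s0;
    try (by case: hs => ->; lra); lra.
have ev : y * z = - (1 / 5) by move: e; rewrite T2; case: hs => // ->; lra.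
have eu : x * z = - s / 5 by move: e; rewrite T2; case: hs => // ->; lra.
have et : y * (x * z) = - s / 5 by move: e; rewrite T2; case: hs => // ->; lra.
have y1 : y = 1.
  have su : x * z != 0 by rewrite eu; case: hs => // ->; lra.
  by apply: (mulIf su); rewrite mul1r et eu.
have zv : z = - (1 / 5) by rewrite -ev y1 mul1r.
have xs : x = s by move: eu; rewrite zv; lra.
(* Here [x = s], and [s = -1] is excluded because [x] is 1 or at most [1/5] in absolute value. *)
case: hs => // hs'.
  by apply: Or31; split=> //; rewrite xs.
by move: hx; rewrite xs hs' normrN normr1; lra.
Qed.

(** * Supports of the products *)

Lemma filter_eq_seq1 (T : eqType) (P : pred T) (l : seq T) (x : T) : uniq l ->
  seq.filter P l = [:: x] <-> x \in l /\ {in l, forall y, P y = (y == x)}.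
Proof.
move=> ul; split=> [e|[xl h]].
  have memP y : (y \in l) && P y = (y == x).
    by rewrite andbC -mem_filter e inE.
  split; first by have := memP x; rewrite eqxx => /andP[].
  by move=> y yl; rewrite -memP yl.
apply: perm_small_eq => //; apply: uniq_perm => //; first exact: filter_uniq.
move=> y; rewrite mem_filter inE; have [yl|yl] := boolP (y \in l).
  by rewrite h// andbT.
by rewrite andbF; apply/esym/negbTE; apply: contraNneq yl => ->.
Qed.

Lemma filter_eq_nil (T : eqType) (P : pred T) (l : seq T) :
  seq.filter P l = [::] <-> {in l, forall y, P y = false}.
Proof.
split=> [e y yl|h].
  by apply/negP => Py; have := mem_filter P y l; rewrite e Py yl.
by rewrite (eq_in_filter h) filter_pred0.
Qed.

Lemma dvdn_prod_primes (s : seq nat) (P : pred nat) (m : nat) : uniq s ->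
  {in s, forall p, prime p} ->
  (\prod_(p <- s | P p) p %| m)%N <-> {in s, forall p, P p -> (p %| m)%N}.
Proof.
elim: s => [_ _|p s IH /= /andP[ps us] sp]; first by rewrite big_nil dvd1n.
have {}IH := IH us (fun q qs => sp q (mem_behead (s := p :: s) qs)).
have pp : prime p by apply: sp; rewrite mem_head.
rewrite big_cons; case: ifP => Pp; last first.
  rewrite IH; split=> h q; last by move=> qs; apply: h; rewrite inE qs orbT.
  by rewrite inE => /orP[/eqP->|/h//]; rewrite Pp.
rewrite Gauss_dvd; last first.
  rewrite coprime_sym big_seq_cond.
  elim/big_rec: _ => [|q x /andP[qs _] xp]; first exact: coprime1n.
  rewrite coprimeMl xp andbT prime_coprime; last by apply: sp; rewrite inE qs orbT.
  rewrite dvdn_prime2//; last by apply: sp; rewrite inE qs orbT.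
  by apply: contraNneq ps => <-.
split=> [/andP[pm /IH h] q|h].
  by rewrite inE => /orP[/eqP->|/h].
rewrite h ?mem_head//=; apply/IH => q qs; apply: h; rewrite inE qs orbT//.
Qed.

(** The primes of [g1 g] that contribute a factor to [Omega j]. The conditions on [frakA] and [calJ]
    say that this set is empty, respectively a single given prime. *)
Definition omega_support (j : nat) (g r : int) : pred nat :=
  fun p => ~~ (p%:Z %| r)%Z && ~~ (j %| logn p (g1 g))%N.

Lemma frakA_dvd (j : nat) (g r : int) : ((frakA j (g1 g))%:Z %| r)%Z <->
  seq.filter (omega_support j g r) (primes (g1 g)) = [::].
Proof.
rewrite dvdzE/= /frakA dvdn_prod_primes ?primes_uniq//; last first.
  by move=> p; rewrite mem_primes => /and3P[].
rewrite filter_eq_nil; split=> h p pg.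
  rewrite /omega_support dvdzE/=; apply/negP => /andP[/negP pr jp].
  by apply: pr; apply: h.
move=> jp; have := h p pg; rewrite /omega_support jp andbT dvdzE/=.
by move/negbFE.
Qed.

Lemma calJ_iff (p j : nat) (g r : int) : prime p -> (0 < j)%N ->
  calJ p g r j <->
  seq.filter (omega_support j g r) (primes (g1 g)) = [:: p].
Proof.
move=> pp j0; rewrite filter_eq_seq1 ?primes_uniq// /omega_support.
rewrite /calJ/=; split.
  move=> [_ jp pr].
  rewrite dvdzE abszM/= dvdn_prod_primes ?primes_uniq//; last first.
    by move=> q; rewrite mem_primes => /and3P[].
  (* A prime not dividing [g1 g] has valuation 0, which every [j] divides. *)
  move=> h; have pg : p \in primes (g1 g).
    by rewrite -logn_gt0 lt0n; apply: contraNneq jp => ->; rewrite dvdn0.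
  split=> // q qg; have qq : prime q by move: qg; rewrite mem_primes => /and3P[].
  have [->|qp] := eqVneq q p; first by rewrite pr jp.
  apply/negbTE; rewrite negb_and !negbK dvdzE/= orbC -implyNb; apply/implyP => jq.
  have := h q qg jq; rewrite Euclid_dvdM// => /orP[|//].
  by rewrite dvdn_prime2// (negbTE qp).
move=> [pg h]; have := h p pg; rewrite eqxx => /andP[pr jp]; split=> //.
rewrite dvdzE abszM/= dvdn_prod_primes ?primes_uniq//; last first.
  by move=> q; rewrite mem_primes => /and3P[].
move=> q qg jq; have := h q qg; rewrite jq andbT.
have [->|qp] := eqVneq q p; first by rewrite dvdn_mulr.
by move/negbFE; rewrite dvdzE/= => qr; rewrite dvdn_mull.
Qed.

Lemma prod_weight_primes (R : realType) (n : nat) (P : pred nat) :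
  coprime n 6 ->
  let X := \prod_(p <- primes n | P p) weight R p in
  [/\ X = 1 \/ `|X| <= 1 / 5, X = 1 <-> seq.filter P (primes n) = [::] &
    X = - (1 / 5) <->
    seq.filter P (primes n) = [:: 5%N] \/ seq.filter P (primes n) = [:: 7%N]].
Proof.
move=> n6 X; rewrite {}/X -big_filter.
have hs p : p \in seq.filter P (primes n) -> prime p /\ (3 < p)%N.
  rewrite mem_filter mem_primes => /andP[_ /and3P[pp _ pn]]; split=> //.
  by have := coprime_dvdl pn n6; case: p pp {pn} => [|[|[|[|]]]].
have [->|ne] := eqVneq (seq.filter P (primes n)) [::].
  rewrite big_nil; split=> //; first by left.
  by split=> [e|[]//]; exfalso; lra.
have [le5 eq5] := prod_weight_le R hs ne.
split=> //; first by right.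
split=> [e|e]; last by rewrite e in ne.
by exfalso; move: le5; rewrite e normr1; lra.
Qed.

Lemma varpi_eq0 (R : realType) (g r : int) : r != 0 -> coprime (g1 g) 6 ->
  let s := varsigma2 R g r * (jacobi 3 (g1 g))%:~R in
  let T := muhat R g * varsigma1 R g r in
  [\/ s = 0, s = 1 | s = -1] -> [\/ T = 0, T = 2 | T = -1] ->
  varpi R g r = 0 <->
  [\/ [/\ [set 2%N; 3%N; 6%N] `<=` calJ 5 g r `|` calJ 7 g r, s = 1 & T = 2],
      ((frakA 2 (g1 g))%:Z %| r)%Z /\ s = -1 |
      ((frakA 3 (g1 g))%:Z %| r)%Z /\ T = -1].
Proof.
move=> r0 n6 s T hs hT.
pose S := fun j => omega_support j g r.
(* A valuation is not divisible by 6 exactly when 2 or 3 fails to divide it, so the support for 6 is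
   the union of the other two. *)
have S6 p : S 6%N p = S 2%N p || S 3%N p.
  rewrite /S /omega_support; case: (_ \in _) => //=; lia.
pose pr (P : pred nat) : R := \prod_(p <- primes (g1 g) | P p) weight R p.
pose x := pr (fun p => S 2%N p && ~~ S 3%N p).
pose y := pr (fun p => S 3%N p && ~~ S 2%N p).
pose z := pr (fun p => S 2%N p && S 3%N p).
have xz : pr (S 2%N) = x * z by rewrite /pr (bigID (S 3%N))/= mulrC.
have O2 : Omega R 2 g r = x * z by [].
have O3 : Omega R 3 g r = y * z.
  rewrite -[LHS]/(pr (S 3%N)) /pr (bigID (S 2%N))/= mulrC; congr (_ * _).
  by apply: eq_bigl => p; rewrite andbC.
have O6 : Omega R 6 g r = x * y * z.
  rewrite -[LHS]/(pr (S 6%N)) /pr (bigID (S 2%N))/= -mulrA [y * z]mulrC mulrA -xz.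
  by congr (_ * _); apply: eq_bigl => p; rewrite S6;
    case: (S 2%N p); case: (S 3%N p).
have vE : varpi R g r = h3 R r / 6 * (1 + s * (x * z) + T * (y * z + s * (x * y * z))).
  by rewrite /varpi O2 O3 O6.
have hn0 : h3 R r / 6 != 0 by rewrite mulf_neq0 ?h3_neq0// invr_eq0.
have -> : (varpi R g r = 0) = (1 + s * (x * z) + T * (y * z + s * (x * y * z)) = 0).
  apply/propext.
  rewrite vE; split=> [/eqP|->]; last by rewrite mulr0.
  by rewrite mulf_eq0 (negbTE hn0)/= => /eqP.
have [hx x1 _] := @prod_weight_primes R (g1 g) (fun p => S 2%N p && ~~ S 3%N p) n6.
have [hy y1 _] := @prod_weight_primes R (g1 g) (fun p => S 3%N p && ~~ S 2%N p) n6.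
have [hz z1 z5] := @prod_weight_primes R (g1 g) (fun p => S 2%N p && S 3%N p) n6.
rewrite -/(pr _) -/x in hx x1; rewrite -/(pr _) -/y in hy y1.
rewrite -/(pr _) -/z in hz z1 z5.
rewrite (varpi_algebra hs hT hx hy hz).
have A2 : (x = 1 /\ z = 1) <-> ((frakA 2 (g1 g))%:Z %| r)%Z.
  rewrite x1 z1 frakA_dvd !filter_eq_nil; split=> [[h1 h2] p pg|h].
    by have := h1 p pg; have := h2 p pg; rewrite /S;
      case: (omega_support 2 g r p); case: (omega_support 3 g r p).
  by split=> p pg; rewrite /S h.
have A3 : (y = 1 /\ z = 1) <-> ((frakA 3 (g1 g))%:Z %| r)%Z.
  rewrite y1 z1 frakA_dvd !filter_eq_nil; split=> [[h1 h2] p pg|h].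
    by have := h1 p pg; have := h2 p pg; rewrite /S;
      case: (omega_support 2 g r p); case: (omega_support 3 g r p).
  by split=> p pg; rewrite /S h// andbF.
(* The supports for 2 and 3 have no private primes and share exactly one prime, 5 or 7; equivalently
   all three supports are that singleton. *)
have AJ : [/\ x = 1, y = 1 & z = - (1 / 5)] <->
    [set 2%N; 3%N; 6%N] `<=` calJ 5 g r `|` calJ 7 g r.
  have JE j : (0 < j)%N -> (calJ 5 g r `|` calJ 7 g r) j <-> exists2 p,
      p \in [:: 5%N; 7%N] & seq.filter (S j) (primes (g1 g)) = [:: p].
    move=> j0; split.
      by move=> [/calJ_iff-/(_ isT j0)|/calJ_iff-/(_ isT j0)] h; [exists 5%N|exists 7%N].
    by move=> [p]; rewrite !inE => /orP[]/eqP-> h; [left|right]; apply/calJ_iff.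
  split.
    move=> [/x1/filter_eq_nil h1 /y1/filter_eq_nil h2 /z5 h3].
    have [p p57 /filter_eq_seq1-/(_ (primes_uniq _)) [pg h]] : exists2 p,
        p \in [:: 5%N; 7%N] &
        seq.filter (fun p => S 2%N p && S 3%N p) (primes (g1 g)) = [:: p].
      by case: h3 => h3; [exists 5%N|exists 7%N].
    have all3 j : j \in [:: 2; 3; 6]%N -> {in primes (g1 g), forall q, S j q = (q == p)}.
      move=> jj q qg; have := h1 q qg; have := h2 q qg; have := h q qg.
      by move: jj; rewrite !inE => /or3P[]/eqP->; rewrite ?S6;
        case: (S 2%N q); case: (S 3%N q).
    by move=> j [[->|->]|->]; apply/JE => //; exists p => //;
      apply/filter_eq_seq1; rewrite ?primes_uniq//; split=> //; apply: all3.
  move=> h.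
  have /JE-/(_ isT) [p6 p657 /filter_eq_seq1-/(_ (primes_uniq _)) [p6g h6]] :=
    h 6%N (or_intror erefl).
  have /JE-/(_ isT) [p2 _ /filter_eq_seq1-/(_ (primes_uniq _)) [p2g h2]] :=
    h 2%N (or_introl (or_introl erefl)).
  have /JE-/(_ isT) [p3 _ /filter_eq_seq1-/(_ (primes_uniq _)) [p3g h3]] :=
    h 3%N (or_introl (or_intror erefl)).
  (* Membership in the union of the two sets allows a different prime for each index. Since the
     support for 6 contains the other two and is a singleton, the primes agree. *)
  have e2 : p2 = p6.
    by apply/eqP; rewrite -(h6 _ p2g) S6 h2// eqxx.
  have e3 : p3 = p6.
    by apply/eqP; rewrite -(h6 _ p3g) S6 h3// eqxx orbT.
  split.
  - by apply/x1/filter_eq_nil => q qg; rewrite h2// h3// e2 e3; case: eqP.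
  - by apply/y1/filter_eq_nil => q qg; rewrite h2// h3// e2 e3; case: eqP.
  - have e : seq.filter (fun p => S 2%N p && S 3%N p) (primes (g1 g)) = [:: p6].
      apply/filter_eq_seq1; rewrite ?primes_uniq//; split=> // q qg.
      by rewrite h2// h3// e2 e3 andbb.
    by apply/z5; move: p657; rewrite e !inE => /orP[]/eqP->; [left|right].
split.
  move=> [[s1 T2 X1 Y1 Z1]|[s1 X1 Z1]|[T1 Y1 Z1]].
  - by apply: Or31; split=> //; apply/AJ.
  - by apply: Or32; split=> //; apply/A2.
  - by apply: Or33; split=> //; apply/A3.
move=> [[/AJ[X1 Y1 Z1] s1 T2]|[/A2[X1 Z1] s1]|[/A3[Y1 Z1] T1]].
- exact: Or31.
- exact: Or32.
- exact: Or33.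
Qed.

(** * Values of the signs *)

(** The integer value of [varsigma2] times the Jacobi symbol, with residues made nonnegative. In the
    first four branches the sign [(-1)^((g1-1)/2)] has cancelled against the one in [chi12], leaving
    [chi3]. *)
Definition sigma (g r : int) : int :=
  let d := delta g in let l := lambda g in let m := mu g in
  let e := ((g1 g - 1) %/ 2)%N in
  if (r == 8 %[mod 24])%Z then (-1) ^+ (d + l + m) * chi3 (g1 g) else
  if (r == 16 %[mod 24])%Z then - ((-1) ^+ (d + l + m) * chi3 (g1 g)) else
  if (r == 20 %[mod 24])%Z then (-1) ^+ (d + m) * chi3 (g1 g) else
  if (r == 4 %[mod 24])%Z then - ((-1) ^+ (d + m) * chi3 (g1 g)) else
  if (r == 2 %[mod 12])%Z then if (2 %| l)%N then chi12 (g1 g) else 0 else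
  if (r == 10 %[mod 12])%Z then if (2 %| l)%N then - chi12 (g1 g) else 0 else
  if (r == 5 %[mod 6])%Z then
    if (2 %| l)%N && (2 %| d + m + e)%N then chi12 (g1 g) else 0 else
  if (r == 1 %[mod 6])%Z then
    if (2 %| l)%N && (2 %| d + m + e)%N then - chi12 (g1 g) else 0 else 0.

Lemma varsigma2_jacobi (R : realType) (g r : int) :
  coprime (g1 g) 6 -> (0 < g1 g)%N ->
  varsigma2 R g r * (jacobi 3 (g1 g))%:~R = (sigma g r)%:~R.
Proof.
move=> n6 n0; have [n2 n3] := coprime6 n6.
rewrite jacobi3//.
have e8 : (r == -8 %[mod 24])%Z = (r == 16 %[mod 24])%Z by lia.
have e20 : (r == -20 %[mod 24])%Z = (r == 4 %[mod 24])%Z by lia.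
have e2 : (r == -2 %[mod 12])%Z = (r == 10 %[mod 12])%Z by lia.
have e5 : (r == -5 %[mod 6])%Z = (r == 1 %[mod 6])%Z by lia.
rewrite /varsigma2 /sigma e8 e20 e2 e5.
set e := ((g1 g - 1) %/ 2)%N.
have c12 (k : nat) : (-1) ^+ (k + e) * (chi12 (g1 g))%:~R =
    ((-1) ^+ k * chi3 (g1 g))%:~R :> R.
  rewrite chi12E// -/e exprD !rmorphM/= !rmorphXn/= rmorphN1.
  by rewrite mulrA -(mulrA (_ ^+ k)) -expr2 sqrr_sign mulr1.
have sgn (k : nat) : (-1) ^+ k = (if (2 %| k)%N then 1 else -1) :> R.
  by rewrite -signr_odd dvdn2; case: (odd k).
case: ifP => _; first by rewrite c12.
case: ifP => _; first by rewrite mulNr c12 rmorphN.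
case: ifP => _; first by rewrite c12.
case: ifP => _; first by rewrite mulNr c12 rmorphN.
case: ifP => _; first by rewrite sgn; case: ifP => _; rewrite ?rmorph0 /=; field.
case: ifP => _.
  by rewrite sgn; case: ifP => _; rewrite ?rmorphN ?rmorph0 /=; field.
case: ifP => _.
  by rewrite !sgn; do 2 (case: ifP => _); rewrite /= ?rmorph0; field.
case: ifP => _.
  by rewrite !sgn; do 2 (case: ifP => _); rewrite /= ?rmorphN ?rmorph0 /=; field.
by rewrite mul0r.
Qed.

Lemma Re_omega_exprz (R : realType) (n : int) :
  complex.Re (omega R ^ n) = if (3 %| n)%Z then 1 else - (1 / 2).
Proof.
pose c : R := cos (pi / 3).
have c0 : 0 < c by apply: cos_gt0_pihalf; have := pi_gt0 R; lra.
(* Reflection and the duplication formula give two expressions for the same cosine, hence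
   [2c^2 + c - 1 = 0], whose positive root is [1/2]. *)
have c23 : cos (2 * pi / 3) = - c :> R.
  have -> : 2 * pi / 3 = pi - pi / 3 :> R by field.
  by rewrite addrC cosDpi cosN.
have c2 : cos (2 * pi / 3) = 2 * c ^+ 2 - 1 :> R.
  by have -> : 2 * pi / 3 = (pi / 3) *+ 2 :> R; [field|rewrite cos_mulr2n /c; ring].
have c12 : c = 1 / 2.
  have : (2 * c - 1) * (c + 1) = 0.
    have -> : (2 * c - 1) * (c + 1) = (2 * c ^+ 2 - 1) + c by ring.
    by rewrite -c2 c23 addNr.
  by move=> /eqP; rewrite mulf_eq0 => /orP[]/eqP; lra.
rewrite c12 in c23.
set t : R := sin (2 * pi / 3).
have t2 : t * t = 3 / 4.
  rewrite -expr2; have := cos2Dsin2 (2 * pi / 3 : R); rewrite c23 -/t => e; lra.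
have omE : omega R = Complex (- (1 / 2)) t by rewrite /omega c23.
have om2 : omega R ^+ 2 = Complex (- (1 / 2)) (- t).
  rewrite omE expr2; apply/eqP; rewrite eq_complex/=; apply/andP; split; apply/eqP.
    by rewrite t2; field.
  by field.
have om3 : omega R ^+ 3 = 1.
  rewrite exprS om2 omE; apply/eqP; rewrite eq_complex/=; apply/andP; split; apply/eqP.
    by rewrite [t * - t]mulrN opprK t2; field.
  by field.
have om0 : omega R != 0.
  by apply: contra_eq_neq om3 => ->; rewrite expr0n eq_sym oner_neq0.
rewrite {1}(divz_eq n 3) expfzDr// mulrC [(n %/ 3)%Z * 3]mulrC -exprz_exp.
rewrite -[omega R ^ 3]/(omega R ^+ 3) om3.
rewrite exp1rz mulr1.
have : (0 <= n %% 3 < 3)%Z by lia.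
have -> : (3 %| n)%Z = (n %% 3 == 0)%Z by lia.
case: (n %% 3)%Z => [[|[|[|]]]|]//= _.
by rewrite c23 -/t t2; field.
Qed.

(** The integer value of [muhat] times [varsigma1]. For odd [r] the exponents of [omega] are
    [a = 1 - lambda], [b = 1 + c] and [a + b]. Modulo 3, the real parts add up to 3 if [a = b = 0],
    to [- 3/2] if [a = b] is nonzero, and to 0 otherwise; [muhat] scales this by [2/3]. *)
Definition tau (g r : int) : int :=
  let l := lambda g in let c := ((g1 g ^ 2 - 1) %/ 3)%N in
  if ~~ (3 %| mu g)%N then 0 else
  if ((r == 2 %[mod 6]) || (r == 4 %[mod 6]))%Z then
    if (3 %| l + c)%N then 2 else 0
  else if ((r == 5 %[mod 6]) || (r == 1 %[mod 6]))%Z then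
    if (l %% 3 == 1)%N && (c %% 3 == 2)%N then 2 else
    if (3 %| l + c)%N then -1 else 0
  else 0.

Lemma muhat_varsigma1 (R : realType) (g r : int) :
  muhat R g * varsigma1 R g r = (tau g r)%:~R.
Proof.
rewrite /muhat /tau; case: ifP => _ /=; last by rewrite mul0r.
rewrite /varsigma1.
have e2 : (r == -2 %[mod 6])%Z = (r == 4 %[mod 6])%Z by lia.
have e5 : (r == -5 %[mod 6])%Z = (r == 1 %[mod 6])%Z by lia.
rewrite e2 e5; set l := lambda g; set c := ((g1 g ^ 2 - 1) %/ 3)%N.
case: ifP => _.
  rewrite Re_omega_exprz (_ : (3 %| _)%Z = (3 %| l + c)%N); last by lia.
  by case: ifP => _; field.
case: ifP => _; last by rewrite mulr0.
rewrite !raddfD/= !Re_omega_exprz.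
have -> : (3 %| 1 - l%:Z)%Z = (l %% 3 == 1)%N by lia.
have -> : (3 %| 1 + c%:Z)%Z = (c %% 3 == 2)%N by lia.
have -> : (3 %| 2 - l%:Z + c%:Z)%Z = ((c + 2) %% 3 == l %% 3)%N by lia.
case: (boolP (l %% 3 == 1)%N) => hl; case: (boolP (c %% 3 == 2)%N) => hc /=;
  do ?[case: ifP => ?]; try lia; by field.
Qed.

(** Since [n^2] modulo 9 depends only on [n] modulo 9, so does [(n^2 - 1) / 3] modulo 3. *)
Lemma sqr_div3_mod3 (n : nat) : ~~ (3 %| n)%N ->
  (((n ^ 2 - 1) %/ 3) %% 3 =
     if (n %% 9 \in [:: 1; 8])%N then 0
     else if (n %% 9 \in [:: 2; 7])%N then 1 else 2)%N.
Proof.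
move=> n3.
have := divn_eq n 9; have : (n %% 9 < 9)%N by rewrite ltn_mod.
set k := (n %/ 9)%N; set m := (n %% 9)%N => m9 nE.
have -> : (n ^ 2 = 9 * (9 * k ^ 2 + 2 * (k * m)) + m * m)%N.
  by rewrite nE -!mulnn; ring.
have : ~~ (3 %| m)%N by move: n3; rewrite nE; lia.
set q := (9 * k ^ 2 + 2 * (k * m))%N.
by rewrite !inE; move: m q m9 {nE} => [|[|[|[|[|[|[|[|[|]]]]]]]]]//= q; lia.
Qed.

Lemma legendre_mod3_nat (n : nat) : legendre n%:Z 3 = chi3 n.
Proof. by rewrite legendre_mod3 /chi3; do ?[case: ifP => ?] => //; lia. Qed.

Lemma legendre_mod3_oppn (n : nat) : legendre (- n%:Z) 3 = - chi3 n.
Proof. by rewrite legendre_mod3 /chi3; do ?[case: ifP => ?] => //; lia. Qed.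

Lemma chi12_eq1 (n : nat) :
  (chi12 n == 1) = (n == 1 %[mod 12])%N || (n == 11 %[mod 12])%N.
Proof. by rewrite /chi12 !inE; do ?[case: ifP => ?]; lia. Qed.

Lemma chi12_eqN1 (n : nat) :
  (chi12 n == -1) = (n == 5 %[mod 12])%N || (n == 7 %[mod 12])%N.
Proof. by rewrite /chi12 !inE; do ?[case: ifP => ?]; lia. Qed.

Lemma sign_mul_eq (n : nat) (c : int) : c = 1 \/ c = -1 ->
  [/\ ((-1) ^+ n * c == 1) = ((-1) ^+ n == c),
      ((-1) ^+ n * c == -1) = ((-1) ^+ n == - c) &
      ((-1) ^+ n * c == 1) || ((-1) ^+ n * c == -1)].
Proof. by rewrite -signr_odd; case: odd => -[->|->]. Qed.

(** Matches the condition on [(g1^2 + 2) / 3] with the test [c = 2] modulo 3 in [tau]; positivity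
    keeps [n^2 - 1] from truncating. *)
Lemma sqrDn2_div3 (n : nat) : (0 < n)%N ->
  ((n ^ 2 + 2) %/ 3 = (n ^ 2 - 1) %/ 3 + 1)%N.
Proof.
move=> n0; have : (0 < n ^ 2)%N by rewrite expn_gt0 n0.
lia.
Qed.

(** One constructor for each class of [r] prime to 3 that [sigma] distinguishes, carrying the truth
    values of the ten congruence tests in [sigma] and [tau], so that a single case analysis settles
    them all. *)
Variant residue24_spec :
  bool -> bool -> bool -> bool -> bool -> bool -> bool -> bool -> bool -> bool ->
  Prop :=
| Residue8 : residue24_spec
    true false false false false false false false true false
| Residue16 : residue24_spec
    false true false false false false false false false true
| Residue20 : residue24_spec
    false false true false false false false false true false
| Residue4 : residue24_spec
    false false false true false false false false false true
| Residue2 : residue24_spec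
    false false false false true false false false true false
| Residue10 : residue24_spec
    false false false false false true false false false true
| Residue5 : residue24_spec
    false false false false false false true false false false
| Residue1 : residue24_spec
    false false false false false false false true false false.

Lemma residue24P (r : int) : ~~ (3 %| r)%Z ->
  residue24_spec (r == 8 %[mod 24])%Z (r == 16 %[mod 24])%Z
    (r == 20 %[mod 24])%Z (r == 4 %[mod 24])%Z (r == 2 %[mod 12])%Z
    (r == 10 %[mod 12])%Z (r == 5 %[mod 6])%Z (r == 1 %[mod 6])%Z
    (r == 2 %[mod 6])%Z (r == 4 %[mod 6])%Z.
Proof.
move=> r3.
have -> : (r == 2 %[mod 12])%Z = (r %% 24 \in [:: 2; 14])%Z by rewrite !inE; lia.
have -> : (r == 10 %[mod 12])%Z = (r %% 24 \in [:: 10; 22])%Z by rewrite !inE; lia.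
have -> : (r == 5 %[mod 6])%Z = (r %% 24 \in [:: 5; 11; 17; 23])%Z by rewrite !inE; lia.
have -> : (r == 1 %[mod 6])%Z = (r %% 24 \in [:: 1; 7; 13; 19])%Z by rewrite !inE; lia.
have -> : (r == 2 %[mod 6])%Z = (r %% 24 \in [:: 2; 8; 14; 20])%Z by rewrite !inE; lia.
have -> : (r == 4 %[mod 6])%Z = (r %% 24 \in [:: 4; 10; 16; 22])%Z by rewrite !inE; lia.
have : (0 <= r %% 24 < 24)%Z by lia.
have : ~~ (3 %| r %% 24)%Z by lia.
case: (r %% 24)%Z => // k.
by do 24 (case: k => [|k]; first by move=> //= _ _; constructor).
Qed.

Lemma sigma_range (g r : int) : ~~ (3 %| g1 g)%N ->
  [\/ sigma g r = 0, sigma g r = 1 | sigma g r = -1].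
Proof.
move=> n3.
have cs := chi3_sign n3.
have [_ _ /orP u] := sign_mul_eq (delta g + lambda g + mu g) cs.
have [_ _ /orP v] := sign_mul_eq (delta g + mu g) cs.
have x : [\/ chi12 (g1 g) = 0, chi12 (g1 g) = 1 | chi12 (g1 g) = -1].
  by rewrite /chi12; do ?[case: ifP => _]; [exact: Or32|exact: Or33|exact: Or31].
rewrite /sigma.
case: ifP => _; first by case: u => /eqP ->; [exact: Or32|exact: Or33].
case: ifP => _; first by case: u => /eqP ->; [exact: Or33|exact: Or32].
case: ifP => _; first by case: v => /eqP ->; [exact: Or32|exact: Or33].
case: ifP => _; first by case: v => /eqP ->; [exact: Or33|exact: Or32].
by do ?[case: ifP => _]; case: x => e; rewrite ?e;
  first [exact: Or31|exact: Or32|exact: Or33].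
Qed.

(** This and the next four equalities turn the propositional lists of conditions into one Boolean
    expression, decided by cases on its atoms. *)
Lemma orbE (a b : bool) : (a \/ b) = (a || b) :> Prop.
Proof. by apply/propext; split=> /orP. Qed.

Lemma andbE_Prop (a b : bool) : (a /\ b) = (a && b) :> Prop.
Proof. by apply/propext; split=> /andP. Qed.

Lemma and3bE (a b c : bool) : [/\ a, b & c] = [&& a, b & c] :> Prop.
Proof. by apply/propext; split=> /and3P. Qed.

Lemma and4bE (a b c d : bool) : [/\ a, b, c & d] = [&& a, b, c & d] :> Prop.
Proof. by apply/propext; split=> /and4P. Qed.

Lemma and5bE (a b c d e : bool) :
  [/\ a, b, c, d & e] = [&& a, b, c, d & e] :> Prop.
Proof. by apply/propext; split=> /and5P. Qed.

Lemma sigma1_tau2 (g r : int) : ~~ (3 %| r)%Z -> ~~ (3 %| g1 g)%N ->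
  (0 < g1 g)%N ->
  sigma g r = 1 /\ tau g r = 2 <->
   ([/\ (r = 8 %[mod 24])%Z, (3 %| mu g)%N,
        (3 %| lambda g + (g1 g ^ 2 - 1) %/ 3)%N
      & (-1) ^+ (delta g + lambda g + mu g) = legendre (g1 g)%:Z 3]
    \/ [/\ (r = 16 %[mod 24])%Z, (3 %| mu g)%N,
        (3 %| lambda g + (g1 g ^ 2 - 1) %/ 3)%N
      & (-1) ^+ (delta g + lambda g + mu g) = legendre (- (g1 g)%:Z) 3]
    \/ [/\ (r = 20 %[mod 24])%Z, (3 %| mu g)%N,
        (3 %| lambda g + (g1 g ^ 2 - 1) %/ 3)%N
      & (-1) ^+ (delta g + mu g) = legendre (g1 g)%:Z 3]
    \/ [/\ (r = 4 %[mod 24])%Z, (3 %| mu g)%N,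
        (3 %| lambda g + (g1 g ^ 2 - 1) %/ 3)%N
      & (-1) ^+ (delta g + mu g) = legendre (- (g1 g)%:Z) 3]
    \/ [/\ (r = 2 %[mod 12])%Z,
        g1 g = 1 %[mod 12] \/ g1 g = 11 %[mod 12], (3 %| mu g)%N,
        (3 %| lambda g + (g1 g ^ 2 - 1) %/ 3)%N & (2 %| lambda g)%N]
    \/ [/\ (r = 10 %[mod 12])%Z,
        g1 g = 5 %[mod 12] \/ g1 g = 7 %[mod 12], (3 %| mu g)%N,
        (3 %| lambda g + (g1 g ^ 2 - 1) %/ 3)%N & (2 %| lambda g)%N]
    \/ [/\ (r = 5 %[mod 6])%Z,
        g1 g = 1 %[mod 12] \/ g1 g = 11 %[mod 12],
        [/\ (3 %| mu g)%N, (3 %| 2 + lambda g)%N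
          & (3 %| (g1 g ^ 2 + 2) %/ 3)%N],
        (2 %| lambda g)%N
      & (2 %| delta g + mu g + (g1 g - 1) %/ 2)%N]
    \/ [/\ (r = 1 %[mod 6])%Z,
        g1 g = 5 %[mod 12] \/ g1 g = 7 %[mod 12],
        [/\ (3 %| mu g)%N, (3 %| 2 + lambda g)%N
          & (3 %| (g1 g ^ 2 + 2) %/ 3)%N],
        (2 %| lambda g)%N
      & (2 %| delta g + mu g + (g1 g - 1) %/ 2)%N]).
Proof.
move=> r3 n3 n0.
have l1 (l : nat) : (l %% 3 == 1)%N = (3 %| 2 + l)%N by lia.
have q2 (q : nat) : (q %% 3 == 2)%N = (3 %| q + 1)%N by lia.
have cs := chi3_sign n3.
rewrite legendre_mod3_nat legendre_mod3_oppn.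
have [u1 uN _] := sign_mul_eq (delta g + lambda g + mu g) cs.
have [v1 vN _] := sign_mul_eq (delta g + mu g) cs.
have x1 := chi12_eq1 (g1 g); have xN := chi12_eqN1 (g1 g).
rewrite sqrDn2_div3// /tau /sigma l1 q2 {l1 q2}.
set u := (-1) ^+ (delta g + lambda g + mu g) in u1 uN *.
set v := (-1) ^+ (delta g + mu g) in v1 vN *.
set x := chi12 (g1 g) in x1 xN *; set c := chi3 (g1 g) in u1 uN v1 vN cs *.
set q := ((g1 g ^ 2 - 1) %/ 3)%N; set e := ((g1 g - 1) %/ 2)%N.
rewrite -!eq_opE !orbE !and3bE !and4bE !and5bE !orbE andbE_Prop.
case: (residue24P r3) => /=; rewrite ?orbF ?eqr_oppLR ?u1 ?uN ?v1 ?vN.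
- by case: (3 %| mu g)%N; case: (3 %| lambda g + q)%N; case: (u == c).
- by case: (3 %| mu g)%N; case: (3 %| lambda g + q)%N; case: (u == - c).
- by case: (3 %| mu g)%N; case: (3 %| lambda g + q)%N; case: (v == c).
- by case: (3 %| mu g)%N; case: (3 %| lambda g + q)%N; case: (v == - c).
- case: (2 %| lambda g)%N; rewrite ?x1 ?andbF//.
  case: (g1 g == 1 %[mod 12]); case: (g1 g == 11 %[mod 12]);
  by case: (3 %| mu g)%N; case: (3 %| lambda g + q)%N.
- case: (2 %| lambda g)%N; rewrite ?eqr_oppLR ?xN ?andbF//.
  case: (g1 g == 5 %[mod 12]); case: (g1 g == 7 %[mod 12]);
  by case: (3 %| mu g)%N; case: (3 %| lambda g + q)%N.
- case: (2 %| lambda g)%N; case: (2 %| delta g + mu g + e)%N;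
    rewrite /= ?x1 ?andbF//.
  case: (g1 g == 1 %[mod 12]); case: (g1 g == 11 %[mod 12]);
  case: (3 %| mu g)%N; case: (3 %| 2 + lambda g)%N; case: (3 %| q + 1)%N;
  by case: (3 %| lambda g + q)%N.
- case: (2 %| lambda g)%N; case: (2 %| delta g + mu g + e)%N;
    rewrite /= ?eqr_oppLR ?xN ?andbF//.
  case: (g1 g == 5 %[mod 12]); case: (g1 g == 7 %[mod 12]);
  case: (3 %| mu g)%N; case: (3 %| 2 + lambda g)%N; case: (3 %| q + 1)%N;
  by case: (3 %| lambda g + q)%N.
Qed.

Lemma sigmaN1 (g r : int) : ~~ (3 %| r)%Z -> ~~ (3 %| g1 g)%N ->
  sigma g r = -1 <->
   ([/\ (r = 8 %[mod 24])%Z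
      & (-1) ^+ (delta g + lambda g + mu g) = legendre (- (g1 g)%:Z) 3]
    \/ [/\ (r = 16 %[mod 24])%Z
      & (-1) ^+ (delta g + lambda g + mu g) = legendre (g1 g)%:Z 3]
    \/ [/\ (r = 20 %[mod 24])%Z
      & (-1) ^+ (delta g + mu g) = legendre (- (g1 g)%:Z) 3]
    \/ [/\ (r = 4 %[mod 24])%Z
      & (-1) ^+ (delta g + mu g) = legendre (g1 g)%:Z 3]
    \/ [/\ (r = 2 %[mod 12])%Z,
        g1 g = 5 %[mod 12] \/ g1 g = 7 %[mod 12] & (2 %| lambda g)%N]
    \/ [/\ (r = 10 %[mod 12])%Z,
        g1 g = 1 %[mod 12] \/ g1 g = 11 %[mod 12] & (2 %| lambda g)%N]
    \/ [/\ (r = 5 %[mod 6])%Z,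
        g1 g = 5 %[mod 12] \/ g1 g = 7 %[mod 12], (2 %| lambda g)%N
      & (2 %| delta g + mu g + (g1 g - 1) %/ 2)%N]
    \/ [/\ (r = 1 %[mod 6])%Z,
        g1 g = 1 %[mod 12] \/ g1 g = 11 %[mod 12], (2 %| lambda g)%N
      & (2 %| delta g + mu g + (g1 g - 1) %/ 2)%N]).
Proof.
move=> r3 n3.
have cs := chi3_sign n3.
rewrite legendre_mod3_nat legendre_mod3_oppn.
have [u1 uN _] := sign_mul_eq (delta g + lambda g + mu g) cs.
have [v1 vN _] := sign_mul_eq (delta g + mu g) cs.
have x1 := chi12_eq1 (g1 g); have xN := chi12_eqN1 (g1 g).
rewrite /sigma.
set u := (-1) ^+ (delta g + lambda g + mu g) in u1 uN *.
set v := (-1) ^+ (delta g + mu g) in v1 vN *.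
set x := chi12 (g1 g) in x1 xN *; set c := chi3 (g1 g) in u1 uN v1 vN cs *.
set e := ((g1 g - 1) %/ 2)%N.
rewrite -!eq_opE !orbE !and3bE !and4bE !andbE_Prop !orbE.
case: (residue24P r3) => /=; rewrite ?orbF ?eqr_oppLR ?opprK ?u1 ?uN ?v1 ?vN//.
- by case: (2 %| lambda g)%N; rewrite ?xN ?andbT ?andbF.
- by case: (2 %| lambda g)%N; rewrite ?eqr_oppLR ?opprK ?x1 ?andbT ?andbF.
- by case: (2 %| lambda g)%N; case: (2 %| delta g + mu g + e)%N;
    rewrite /= ?xN ?andbT ?andbF.
- by case: (2 %| lambda g)%N; case: (2 %| delta g + mu g + e)%N;
    rewrite /= ?eqr_oppLR ?opprK ?x1 ?andbT ?andbF.
Qed.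

Lemma tauN1 (g r : int) : ~~ (3 %| r)%Z -> ~~ (3 %| g1 g)%N ->
  tau g r = -1 <->
   ([/\ (r = 1 %[mod 6])%Z \/ (r = -1 %[mod 6])%Z,
        g1 g = 1 %[mod 9] \/ g1 g = 8 %[mod 9],
        (3 %| lambda g)%N & (3 %| mu g)%N]
    \/ [/\ (r = 1 %[mod 6])%Z \/ (r = -1 %[mod 6])%Z,
        g1 g = 2 %[mod 9] \/ g1 g = 7 %[mod 9],
        (3 %| lambda g + 1)%N & (3 %| mu g)%N]).
Proof.
move=> r3 n3.
have rN1 : (r == -1 %[mod 6])%Z = (r == 5 %[mod 6])%Z by lia.
have := sqr_div3_mod3 n3; rewrite /tau !inE.
set q := ((g1 g ^ 2 - 1) %/ 3)%N => hq.
rewrite -!eq_opE rN1 !orbE !and4bE !orbE.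
(* The pairs [(lambda, q)] modulo 3 with sum 0 are [(0, 0)], [(1, 2)] and [(2, 1)]. Excluding
   [(1, 2)] leaves the two families, and [q] is read off from [g1] modulo 9. *)
have key : ~~ ((lambda g %% 3 == 1) && (q %% 3 == 2))%N && (3 %| lambda g + q)%N =
    ((g1 g == 1 %[mod 9]) || (g1 g == 8 %[mod 9])) && (3 %| lambda g)%N ||
    ((g1 g == 2 %[mod 9]) || (g1 g == 7 %[mod 9])) && (3 %| lambda g + 1)%N.
  clear rN1 r3 r; move: n3 hq; case: ifP => h1; [|case: ifP => h2]; lia.
have ifE (b c : bool) : ((if ~~ (3 %| mu g)%N then 0 else if b then
    (if (3 %| lambda g + q)%N then 2 else 0) else if c then
    (if (lambda g %% 3 == 1)%N && (q %% 3 == 2)%N then 2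
     else if (3 %| lambda g + q)%N then -1 else 0) else 0) == -1 :> int) =
  [&& (3 %| mu g)%N, ~~ b, c &
      ~~ ((lambda g %% 3 == 1) && (q %% 3 == 2))%N && (3 %| lambda g + q)%N].
  by case: (3 %| mu g)%N; case: b; case: c;
    case: ((lambda g %% 3 == 1) && (q %% 3 == 2))%N; case: (3 %| lambda g + q)%N.
rewrite ifE key.
case: (residue24P r3) => //=; rewrite ?andbF//;
by case: (g1 g == 1 %[mod 9]); case: (g1 g == 8 %[mod 9]);
  case: (g1 g == 2 %[mod 9]); case: (g1 g == 7 %[mod 9]);
  case: (3 %| lambda g)%N; case: (3 %| lambda g + 1)%N; case: (3 %| mu g)%N.
Qed.

Theorem theorem7p3 (R : realType) (r g : int)
    (r_neq0 : r <> 0) (r_not3 : ~ (3 %| r)%Z) (g_neq0 : g <> 0) :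
  varpi R g r = 0 <->
  (* (I) *)
  ([set 2%N; 3%N; 6%N] `<=` calJ 5 g r `|` calJ 7 g r /\
   ([/\ (r = 8 %[mod 24])%Z, (3 %| mu g)%N,
        (3 %| lambda g + (g1 g ^ 2 - 1) %/ 3)%N
      & (-1) ^+ (delta g + lambda g + mu g) = legendre (g1 g)%:Z 3]
    \/ [/\ (r = 16 %[mod 24])%Z, (3 %| mu g)%N,
        (3 %| lambda g + (g1 g ^ 2 - 1) %/ 3)%N
      & (-1) ^+ (delta g + lambda g + mu g) = legendre (- (g1 g)%:Z) 3]
    \/ [/\ (r = 20 %[mod 24])%Z, (3 %| mu g)%N,
        (3 %| lambda g + (g1 g ^ 2 - 1) %/ 3)%N
      & (-1) ^+ (delta g + mu g) = legendre (g1 g)%:Z 3]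
    \/ [/\ (r = 4 %[mod 24])%Z, (3 %| mu g)%N,
        (3 %| lambda g + (g1 g ^ 2 - 1) %/ 3)%N
      & (-1) ^+ (delta g + mu g) = legendre (- (g1 g)%:Z) 3]
    \/ [/\ (r = 2 %[mod 12])%Z,
        g1 g = 1 %[mod 12] \/ g1 g = 11 %[mod 12], (3 %| mu g)%N,
        (3 %| lambda g + (g1 g ^ 2 - 1) %/ 3)%N & (2 %| lambda g)%N]
    \/ [/\ (r = 10 %[mod 12])%Z,
        g1 g = 5 %[mod 12] \/ g1 g = 7 %[mod 12], (3 %| mu g)%N,
        (3 %| lambda g + (g1 g ^ 2 - 1) %/ 3)%N & (2 %| lambda g)%N]
    \/ [/\ (r = 5 %[mod 6])%Z,
        g1 g = 1 %[mod 12] \/ g1 g = 11 %[mod 12],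
        [/\ (3 %| mu g)%N, (3 %| 2 + lambda g)%N
          & (3 %| (g1 g ^ 2 + 2) %/ 3)%N],
        (2 %| lambda g)%N
      & (2 %| delta g + mu g + (g1 g - 1) %/ 2)%N]
    \/ [/\ (r = 1 %[mod 6])%Z,
        g1 g = 5 %[mod 12] \/ g1 g = 7 %[mod 12],
        [/\ (3 %| mu g)%N, (3 %| 2 + lambda g)%N
          & (3 %| (g1 g ^ 2 + 2) %/ 3)%N],
        (2 %| lambda g)%N
      & (2 %| delta g + mu g + (g1 g - 1) %/ 2)%N]))
  \/
  (* (II) *)
  (((frakA 2 (g1 g))%:Z %| r)%Z /\
   ([/\ (r = 8 %[mod 24])%Z
      & (-1) ^+ (delta g + lambda g + mu g) = legendre (- (g1 g)%:Z) 3]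
    \/ [/\ (r = 16 %[mod 24])%Z
      & (-1) ^+ (delta g + lambda g + mu g) = legendre (g1 g)%:Z 3]
    \/ [/\ (r = 20 %[mod 24])%Z
      & (-1) ^+ (delta g + mu g) = legendre (- (g1 g)%:Z) 3]
    \/ [/\ (r = 4 %[mod 24])%Z
      & (-1) ^+ (delta g + mu g) = legendre (g1 g)%:Z 3]
    \/ [/\ (r = 2 %[mod 12])%Z,
        g1 g = 5 %[mod 12] \/ g1 g = 7 %[mod 12] & (2 %| lambda g)%N]
    \/ [/\ (r = 10 %[mod 12])%Z,
        g1 g = 1 %[mod 12] \/ g1 g = 11 %[mod 12] & (2 %| lambda g)%N]
    \/ [/\ (r = 5 %[mod 6])%Z,
        g1 g = 5 %[mod 12] \/ g1 g = 7 %[mod 12], (2 %| lambda g)%N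
      & (2 %| delta g + mu g + (g1 g - 1) %/ 2)%N]
    \/ [/\ (r = 1 %[mod 6])%Z,
        g1 g = 1 %[mod 12] \/ g1 g = 11 %[mod 12], (2 %| lambda g)%N
      & (2 %| delta g + mu g + (g1 g - 1) %/ 2)%N]))
  \/
  (* (III) *)
  (((frakA 3 (g1 g))%:Z %| r)%Z /\
   ([/\ (r = 1 %[mod 6])%Z \/ (r = -1 %[mod 6])%Z,
        g1 g = 1 %[mod 9] \/ g1 g = 8 %[mod 9],
        (3 %| lambda g)%N & (3 %| mu g)%N]
    \/ [/\ (r = 1 %[mod 6])%Z \/ (r = -1 %[mod 6])%Z,
        g1 g = 2 %[mod 9] \/ g1 g = 7 %[mod 9],
        (3 %| lambda g + 1)%N & (3 %| mu g)%N])).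
Proof.
have r0 : r != 0 by apply/eqP.
have r3 : ~~ (3 %| r)%Z by apply/negP.
have [_ n0 n6 _] := factorization_g (introN eqP g_neq0).
have [_ n3] := coprime6 n6.
have := @varpi_eq0 R g r r0 n6; cbv zeta.
rewrite varsigma2_jacobi// muhat_varsigma1.
(* In characteristic 0 the conditions on the two signs can be checked in the integers, where they
   are decidable. *)
have intrE (a b : int) : (a%:~R = b%:~R :> R) <-> a = b.
  by split=> [/eqP|->//]; rewrite eqr_int => /eqP.
have hs : [\/ (sigma g r)%:~R = 0 :> R, (sigma g r)%:~R = 1 :> R |
    (sigma g r)%:~R = -1 :> R].
  case: (sigma_range r n3) => ->; [exact: Or31|exact: Or32|exact: Or33].
have hT : [\/ (tau g r)%:~R = 0 :> R, (tau g r)%:~R = 2 :> R |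
    (tau g r)%:~R = -1 :> R].
  rewrite /tau; do ?[case: ifP => ?]; by [exact: Or31|exact: Or32|exact: Or33].
move=> /(_ hs hT) ->.
have s1 := intrE (sigma g r) 1; have sN1 := intrE (sigma g r) (-1).
have t2 := intrE (tau g r) 2; have tN1 := intrE (tau g r) (-1).
have I := @sigma1_tau2 g r r3 n3 n0; have II := @sigmaN1 g r r3 n3.
have III := @tauN1 g r r3 n3.
split.
  move=> [[J /s1 s /t2 t]|[A /sN1 s]|[A /tN1 t]].
  - by left; split=> //; apply/I.
  - by right; left; split=> //; apply/II.
  - by right; right; split=> //; apply/III.
move=> [[J /I[/s1 s /t2 t]]|[[A /II/sN1 s]|[A /III/tN1 t]]].
- exact: Or31.
- exact: Or32.
- exact: Or33.
Qed.
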